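(* Let $Q$ be a convex polygon with no two adjacent edges collinear, and let $P=\operatorname{Pyr}(Q)\subset\mathbb R^3$ be any pyramid over $Q$ with apex $a$. For each unordered pair $\{e,f\}$ of parallel edges of $Q$, $e=uv$, $f=xy$, with associated block of square cells $B,U,V,X,Y$ of $X(P)$, the local belt space has exactly three primitive circuits: \[ \{B,U,V\},\qquad\{B,X,Y\},\qquad\{U,V,X,Y\}. \] Consequently, the primitive rational belts of $P$ are exactly these local circuits over all parallel-edge blocks; that is, the supports of the primitive rational belts of $P$ are exactly these sets, as $\{e,f\}$ ranges over all unordered pairs of parallel edges of $Q$.
   Context: A convex polyhedron $P\subset\mathbb R^3$ means a compact full-dimensional convex polytope. Two points of $P$ are antipodal if there are two parallel supporting planes of $P$, one through each point, that contain $P$ between them. A pyramid over $Q$ is the convex hull of $Q$, placed in an affine plane (the base plane), and an apex $a$ outside that plane. The antipodal graph $G_A(P)$ has as vertices the vertices of $P$, with an edge $vw$ whenever $v,w$ are distinct antipodal vertices. The antipodal square complex $X(P)$ is the two-dimensional finite CW complex obtained from $G_A(P)$ by attaching one square 2-cell $S_{e,f}$ for every unordered pair $\{e,f\}$ of distinct edges of $P$ whose midpoints are antipodal: if $e=vv'$ and $f=ww'$, the square is attached along the four-cycle $v-w-v'-w'-v$ (such $e,f$ are disjoint, and the four vertex pairs used are antipodal). A rational antipodal belt is an element $Z\in C_2(X(P);\mathbb Q)$ with cellular boundary $\partial Z=0$. A nonzero rational belt is primitive if its support (the set of square cells with nonzero coefficient) is inclusion-minimal among the supports of nonzero rational belts;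 the corresponding supports are called (primitive) circuits. For a pair of parallel opposite base edges $e=uv$, $f=xy$, the associated parallel-edge block consists of the five square cells $B=S_{e,f}$, $U=S_{au,f}$, $V=S_{av,f}$, $X=S_{ax,e}$, $Y=S_{ay,e}$. With coherent orientations one has $\partial B+\partial U-\partial V=0$ and $\partial B+\partial X-\partial Y=0$. The local belt space of the block is the span over $\mathbb Q$ of $Z_1=B+U-V$ and $Z_2=B+X-Y$; its primitive circuits are the inclusion-minimal supports of its nonzero elements. *)

(* Defs.v *)
From HB Require Import structures.
From mathcomp Require Import all_boot all_order all_algebra.
From mathcomp Require Import boolp classical_sets reals.

Set Implicit Arguments.
Unset Strict Implicit.
Unset Printing Implicit Defensive.

Import Order.TTheory GRing.Theory Num.Theory.
Local Open Scope ring_scope.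

(* A polytope in R^3 is given by a finite family of points p : I -> R^3 and is
   the convex hull of that family.  Faces, edges and cells are then recorded by
   the labels in I of their vertices. *)

Definition dot (R : realType) (c x : 'rV[R]_3) : R :=
  \sum_(k < 3) c 0 k * x 0 k.

Section Polytope.
Variables (R : realType) (I : finType) (p : I -> 'rV[R]_3).

Definition hull (A : {set I}) : set 'rV[R]_3 :=
  [set z | exists t : I -> R,
     [/\ forall i, 0 <= t i, \sum_(i in A) t i = 1
       & z = \sum_(i in A) t i *: p i]]%classic.

Definition polytope : set 'rV[R]_3 := hull [set: I].

(* F is the set of maximizers of a linear functional on the polytope; the
   functional 0 gives the polytope itself. *)
Definition is_face (F : set 'rV[R]_3) : Prop :=
  exists c : 'rV[R]_3,
    F = [set z | polytope z /\ forall z', polytope z' -> dot c z' <= dot c z]%classic.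

Definition is_vertex (i : I) : bool := `[< is_face (hull [set i]) >].

(* For an injective family, hull e with #|e| = 2 is a nondegenerate segment. *)
Definition is_edge (e : {set I}) : bool :=
  (#|e| == 2)%N && `[< is_face (hull e) >].

Definition midpoint (e : {set I}) : 'rV[R]_3 := 2^-1 *: \sum_(i in e) p i.

(* The parallel supporting planes are dot c z = alpha and dot c z = beta. *)
Definition antipodal (x y : 'rV[R]_3) : Prop :=
  [/\ polytope x, polytope y
    & exists (c : 'rV[R]_3) (alpha beta : R),
      [/\ c != 0, dot c x = alpha, dot c y = beta
        & forall z, polytope z -> alpha <= dot c z <= beta]].

Definition direction : {vspace 'rV[R]_3} :=
  <<[seq p ij.1 - p ij.2 | ij : I * I]>>%VS.

Definition affine_hull : set 'rV[R]_3 :=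
  [set z | exists i, z - p i \in direction]%classic.

(* Direction of the line through p i and p j. *)
Definition line_dir (i j : I) : {vspace 'rV[R]_3} := <[p j - p i]>%VS.

(* A two-dimensional convex polytope in R^3, labelled by its vertices. *)
Definition convex_polygon : Prop :=
  [/\ injective p, forall i, is_vertex i & \dim direction = 2%N].

Definition no_collinear_adjacent_edges : Prop :=
  forall u v w : I, is_edge [set u; v] -> is_edge [set u; w] -> v != w ->
    line_dir u v <> line_dir u w.

(* {uv, xy} is an unordered pair of distinct parallel edges. *)
Definition parallel_edges (u v x y : I) : Prop :=
  [/\ is_edge [set u; v], is_edge [set x; y], [set u; v] != [set x; y]
    & line_dir u v = line_dir x y].

(* Cells of the antipodal square complex, by vertex labels: an edge of the
   antipodal graph is {v, w}, a square cell S_{e,f} is {e, f}. *)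
Definition is_antipodal_edge (g : {set I}) : bool :=
  [exists v, exists w,
    [&& g == [set v; w], v != w, is_vertex v, is_vertex w
      & `[< antipodal (p v) (p w) >]]].

Definition is_square (s : {set {set I}}) : bool :=
  [exists e, exists f,
    [&& s == [set e; f], e != f, is_edge e, is_edge f
      & `[< antipodal (midpoint e) (midpoint f) >]]].

Definition antipodal_edge : finType := {g : {set I} | is_antipodal_edge g}.
Definition square : finType := {s : {set {set I}} | is_square s}.

Definition C1 : vectType rat := {ffun antipodal_edge -> rat^o}.
Definition C2 : vectType rat := {ffun square -> rat^o}.

End Polytope.

(* The attaching cycle v-w-v'-w' of S_{e,f}, e = {v, v'}, f = {w, w'}.  The
   enumeration order of the finite sets fixes an orientation of each cell. *)
Definition attaching_cycle (I : finType) (s : {set {set I}}) : seq I :=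
  if enum s is [:: e; f] then
    if (enum e, enum f) is ([:: v; v'], [:: w; w'])
    then [:: v; w; v'; w'] else [::]
  else [::].

(* Signed number of times the closed walk c passes from v to w. *)
Definition crossings (I : finType) (c : seq I) (v w : I) : rat :=
  \sum_(st <- zip c (rot 1 c)) ((st == (v, w))%:R - (st == (w, v))%:R).

Section Chains.
Variables (R : realType) (I : finType) (p : I -> 'rV[R]_3).

(* Cellular boundary; the 1-cell {v, w} is oriented by its enumeration. *)
Definition boundary (Z : C2 p) : C1 p :=
  [ffun g : antipodal_edge p =>
     \sum_(S : square p) Z S *
       (if enum (val g) is [:: v; w]
        then crossings (attaching_cycle (val S)) v w else 0)].

Definition rational_belt : set (C2 p) := [set Z | boundary Z = 0]%classic.

Definition support (Z : C2 p) : {set {set {set I}}} :=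
  [set val S | S : square p & Z S != 0].

Definition primitive_in (L : set (C2 p)) (Z : C2 p) : Prop :=
  [/\ L Z, Z != 0
    & forall Z', L Z' -> Z' != 0 -> support Z' \subset support Z ->
      support Z' = support Z].

Definition primitive_circuit (L : set (C2 p)) (W : {set {set {set I}}}) : Prop :=
  exists2 Z, primitive_in L Z & support Z = W.

Definition cell (v v' w w' : I) : {set {set I}} := [set [set v; v']; [set w; w']].

(* The cell S_{vv',ww'} with the orientation in which its boundary runs
   v -> w -> v' -> w' -> v; the sign compares this with the direction in which
   the chosen attaching cycle passes the edge vw. *)
Definition oriented_cell (v v' w w' : I) : C2 p :=
  [ffun S : square p =>
     if val S == cell v v' w w'
     then crossings (attaching_cycle (val S)) v w else 0].

End Chains.

Definition pyramid (R : realType) (I : finType) (q : I -> 'rV[R]_3)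
    (a : 'rV[R]_3) (o : option I) : 'rV[R]_3 :=
  if o is Some i then q i else a.

(* The block of e = uv, f = xy; the label of the apex is None. *)
Section Block.
Variables (I : finType) (u v x y : I).

Definition cellB : {set {set option I}} := cell (Some u) (Some v) (Some x) (Some y).
Definition cellU : {set {set option I}} := cell None (Some u) (Some x) (Some y).
Definition cellV : {set {set option I}} := cell None (Some v) (Some x) (Some y).
Definition cellX : {set {set option I}} := cell None (Some x) (Some u) (Some v).
Definition cellY : {set {set option I}} := cell None (Some y) (Some u) (Some v).

Definition block_circuits : seq {set {set {set option I}}} :=
  [:: [set cellB; cellU; cellV]; [set cellB; cellX; cellY];
      [set cellU; cellV; cellX; cellY]].

(* In these orientations, bd B + bd U - bd V = 0 and bd B + bd X - bd Y = 0. *)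
Definition local_belts (R : realType) (q : I -> 'rV[R]_3) (a : 'rV[R]_3) :
    {vspace C2 (pyramid q a)} :=
  let B := oriented_cell (pyramid q a) (Some u) (Some v) (Some x) (Some y) in
  let U := oriented_cell (pyramid q a) None (Some u) (Some x) (Some y) in
  let V := oriented_cell (pyramid q a) None (Some v) (Some x) (Some y) in
  let X := oriented_cell (pyramid q a) (Some u) (Some v) None (Some x) in
  let Y := oriented_cell (pyramid q a) (Some u) (Some v) None (Some y) in
  <<[:: B + U - V; B + X - Y]>>%VS.

End Block.

(* Main.v *)
(* The squares of a pyramid with apex a are the S_{e,f} with e, f parallel base
   edges, and the S_{au,f} with u a base vertex farthest from the base edge f = xy.
   Let t(x,y) be the sum over u of the coefficients of a belt on the S_{au,xy}. The
   boundary condition at the edges ax says that t is a flow on the boundary cycle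
   of Q, hence a constant. Pairing the boundary with the 1-cochain
   xu |-> area(o,x,u), which on a square is the cross product of its two edges and
   thus kills the squares on parallel base edges, gives t * (a positive area) = 0.
   So t = 0: the coefficients on S_{au,xy} vanish unless xy has a parallel edge uv,
   and then U + V = 0 and X + Y = 0 for the five coefficients of the block. A side
   of the trapezoid uvxy is an antipodal edge lying on squares of the block only,
   and the boundary condition there expresses B through U and X. Hence every belt
   restricts on each block to an element U Z_1 + X Z_2 of its local belt space. *)

Require Import Defs.
From mathcomp Require Import all_boot all_order all_algebra.
From mathcomp Require Import boolp classical_sets reals.
From mathcomp Require Import ring lra.

Set Implicit Arguments.
Unset Strict Implicit.
Unset Printing Implicit Defensive.

Import Order.TTheory GRing.Theory Num.Theory.
Local Open Scope ring_scope.

(** * Chains of oriented squares *)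

Lemma enum_set2 (T : finType) (x y : T) : x != y ->
  enum [set x; y] = [:: x; y] \/ enum [set x; y] = [:: y; x].
Proof.
move=> nxy.
have pe : perm_eq (enum [set x; y]) [:: x; y].
  apply: uniq_perm; rewrite ?enum_uniq //= ?inE ?nxy // => z.
  by rewrite mem_enum !inE.
have := perm_size pe; have := perm_mem pe.
case: (enum _) (enum_uniq [set x; y]) => [|a [|b [|]]] //=; rewrite inE andbT => nab m _.
have ma : a \in [:: x; y] by rewrite -m mem_head.
have mb : b \in [:: x; y] by rewrite -m !inE eqxx orbT.
move: ma mb nab; rewrite !inE.
by case/orP=> /eqP-> /orP[]/eqP->; rewrite ?eqxx // => _; [left|right].
Qed.

Lemma set2_inj (T : finType) (x y z : T) : [set x; y] = [set x; z] -> y = z.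
Proof.
move/setP=> h; have := h y; have := h z; rewrite !inE !eqxx !orbT.
by case: eqVneq => [->|nzx] /=; [case: eqVneq|move/eqP].
Qed.

Section Crossings.
Variable I : finType.
Implicit Types (a b s t v w : I) (c : seq I).

Definition step a b s t : rat := ((a, b) == (s, t))%:R - ((a, b) == (t, s))%:R.

Lemma stepNl a b s t : step b a s t = - step a b s t.
Proof. by rewrite /step !xpair_eqE opprB ![(b == _) && _]andbC. Qed.

Lemma step1 a b : a != b -> step a b a b = 1.
Proof. by move=> nab; rewrite /step !xpair_eqE !eqxx (negPf nab) subr0. Qed.

Lemma step0 a b s t : ~~ [|| (a == s) && (b == t) | (a == t) && (b == s)] ->
  step a b s t = 0.
Proof.
by rewrite negb_or /step !xpair_eqE => /andP[/negPf-> /negPf->]; rewrite subrr.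
Qed.

Lemma crossingsN c s t : crossings c t s = - crossings c s t.
Proof. by rewrite /crossings -sumrN; apply: eq_bigr => st _; rewrite opprB. Qed.

Lemma crossings4 v v' w w' s t : crossings [:: v; w; v'; w'] s t =
  step v w s t + step w v' s t + step v' w' s t + step w' v s t.
Proof. by rewrite /crossings /= !big_cons big_nil addr0 !addrA. Qed.

Lemma crossings4_first v v' w w' : uniq [:: v; v'; w; w'] ->
  crossings [:: v; w; v'; w'] v w = 1.
Proof.
rewrite /= !inE !negb_or andbT => /and3P[/and3P[n1 n2 n3] /andP[n4 n5] n6].
have neC (x y : I) : x != y -> ((x == y) = false) * ((y == x) = false).
  by move=> nxy; rewrite [y == x]eq_sym (negPf nxy).
have ne := (neC _ _ n1, neC _ _ n2, neC _ _ n3, neC _ _ n4, neC _ _ n5, neC _ _ n6).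
by rewrite crossings4 step1 // !step0 ?addr0 // !ne ?andbF.
Qed.

Lemma cellC v v' w w' : cell v v' w w' = cell w w' v v'.
Proof. by rewrite /cell finset.setUC. Qed.

Lemma cellNl v v' w w' : cell v v' w w' = cell v' v w w'.
Proof. by rewrite /cell (finset.setUC [set v]). Qed.

Lemma cellNr v v' w w' : cell v v' w w' = cell v v' w' w.
Proof. by rewrite /cell (finset.setUC [set w]). Qed.

Lemma attaching_cycle_cell v v' w w' : uniq [:: v; v'; w; w'] ->
  exists2 e : rat, e ^+ 2 = 1 & forall s t,
    crossings (attaching_cycle (cell v v' w w')) s t
    = e * crossings [:: v; w; v'; w'] s t.
Proof.
rewrite /= !inE !negb_or andbT => /and3P[/and3P[n1 n2 n3] /andP[n4 n5] n6].
have nef : [set v; v'] != [set w; w'].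
  apply/eqP => /setP/(_ v); rewrite !inE eqxx /=.
  by rewrite (negPf n2) (negPf n3).
rewrite /attaching_cycle /cell.
have one : (1 : rat) ^+ 2 = 1 by rewrite expr1n.
have mone : (-1 : rat) ^+ 2 = 1 by rewrite sqrrN expr1n.
case: (enum_set2 nef) => ->; case: (enum_set2 n1) => ->; case: (enum_set2 n6) => ->.
all: first [exists 1 => // s t; rewrite !crossings4 ?(stepNl v w) ?(stepNl v w') ?(stepNl v' w)
            ?(stepNl v' w'); ring
        |exists (-1) => // s t; rewrite !crossings4 ?(stepNl v w) ?(stepNl v w') ?(stepNl v' w)
            ?(stepNl v' w'); ring].
Qed.
End Crossings.

Section OrientedCoefficients.
Variables (R : realType) (I : finType) (p : I -> 'rV[R]_3).
Hypothesis square_uniq : forall v v' w w',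
  is_square p (cell v v' w w') -> uniq [:: v; v'; w; w'].
Hypothesis square_antipodal_edge : forall v v' w w',
  is_square p (cell v v' w w') -> is_antipodal_edge p [set v; w].
Implicit Types (Z : C2 p) (S : square p) (s t k l v w : I).

(* The coefficient in Z of the cell S_{vv',ww'} with the orientation of
   [oriented_cell]; it is 0 when there is no such cell. *)
Definition coef Z v v' w w' : rat :=
  \sum_(S : square p | val S == cell v v' w w')
     Z S * crossings (attaching_cycle (val S)) v w.

Definition boundary_at Z s t : rat :=
  \sum_(S : square p) Z S * crossings (attaching_cycle (val S)) s t.

Lemma square_cellP S : exists v v' w w', val S = cell v v' w w'.
Proof.
case: S => s /= /existsP[e /existsP[f /and5P[/eqP-> _ /andP[ce _] /andP[cf _] _]]].
have /cards2P[v [v' [_ ->]]] := ce; have /cards2P[w [w' [_ ->]]] := cf.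
by exists v, v', w, w'.
Qed.

Lemma crossings_square S v v' w w' : val S = cell v v' w w' -> forall s t,
  crossings (attaching_cycle (val S)) s t
  = crossings (attaching_cycle (val S)) v w * crossings [:: v; w; v'; w'] s t.
Proof.
move=> eS s t; have := valP S; rewrite eS => /square_uniq u4.
have [e _ ce] := attaching_cycle_cell u4.
by rewrite !ce (crossings4_first u4) mulr1.
Qed.

Lemma crossings_square_sqr S v v' w w' : val S = cell v v' w w' ->
  crossings (attaching_cycle (val S)) v w ^+ 2 = 1.
Proof.
move=> eS; have := valP S; rewrite eS => /square_uniq u4.
have [e e2 ce] := attaching_cycle_cell u4.
by rewrite !ce (crossings4_first u4) mulr1.
Qed.

Lemma coef_square Z S v v' w w' : val S = cell v v' w w' ->
  coef Z v v' w w' = Z S * crossings (attaching_cycle (val S)) v w.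
Proof.
move=> eS; rewrite /coef (big_pred1 S) // => S' /=.
by rewrite -eS; apply/eqP/eqP => [/val_inj|->].
Qed.

Lemma square_coef Z S v v' w w' : val S = cell v v' w w' ->
  Z S = coef Z v v' w w' * crossings (attaching_cycle (val S)) v w.
Proof.
by move=> eS; rewrite (coef_square _ eS) -mulrA -expr2 (crossings_square_sqr eS) mulr1.
Qed.

Lemma coef_neq0 Z v v' w w' : coef Z v v' w w' != 0 -> is_square p (cell v v' w w').
Proof.
apply: contraNT => nS; rewrite /coef big_pred0 // => S.
by apply/negP => /eqP eS; have := valP S; rewrite eS (negPf nS).
Qed.

Lemma coefNl Z v v' w w' : coef Z v' v w w' = - coef Z v v' w w'.
Proof.
rewrite /coef -sumrN cellNl; apply: eq_bigr => S /eqP eS.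
have /square_uniq u4 : is_square p (cell v v' w w') by rewrite -eS (valP S).
rewrite (crossings_square eS v' w).
suff -> : crossings [:: v; w; v'; w'] v' w = -1 by ring.
have u4' : uniq [:: v'; v; w; w'].
  by move: u4; rewrite /= !inE (eq_sym v) !negb_or -!andbA => /and5P[-> -> -> -> /andP[-> ->]].
rewrite -(crossings4_first u4') !crossings4 (stepNl w v) (stepNl v' w) (stepNl w' v').
by rewrite (stepNl v w'); ring.
Qed.

Lemma coefC Z v v' w w' : coef Z w w' v v' = - coef Z v v' w w'.
Proof.
by rewrite /coef -sumrN cellC; apply: eq_bigr => S _; rewrite crossingsN mulrN.
Qed.

Lemma coefNr Z v v' w w' : coef Z v v' w' w = - coef Z v v' w w'.
Proof. by rewrite coefC coefNl coefC opprK. Qed.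

Lemma boundary_at_coef Z s t : boundary_at Z s t = \sum_k \sum_l coef Z s k t l.
Proof.
transitivity (\sum_k \sum_l \sum_(S : square p) Z S *
   ((val S == cell s k t l)%:R * crossings (attaching_cycle (val S)) s t)); last first.
  apply: eq_bigr => k _; apply: eq_bigr => l _; rewrite /coef [RHS]big_mkcond.
  by apply: eq_bigr => S _; case: eqP => _; rewrite ?mul1r // mul0r mulr0.
under eq_bigr do rewrite exchange_big.
rewrite exchange_big /boundary_at /=; apply: eq_bigr => S _.
under eq_bigr do rewrite -mulr_sumr -mulr_suml.
rewrite -mulr_sumr -mulr_suml; congr (_ * _).
have [->|nz] := eqVneq (crossings (attaching_cycle (val S)) s t) 0; first by rewrite mulr0.
suff [k0 [l0 eS]] : exists k0 l0, val S = cell s k0 t l0.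
  have /square_uniq u4 : is_square p (cell s k0 t l0) by rewrite -eS (valP S).
  rewrite eS -[LHS]mul1r; congr (_ * _).
  rewrite (bigD1 k0) //= [X in _ + X]big1 => [|k nk].
    rewrite (bigD1 l0) //=. rewrite eqxx big1 ?addr0 // => l nl.
    case: eqP => // ec; case/negP: nl; apply/eqP.
    move/setP: ec => /(_ [set t; l]); rewrite !inE eqxx orbT => /orP[]/eqP.
      move/setP/(_ t); rewrite !inE eqxx; move: u4 => /=.
      by rewrite !inE !negb_or (eq_sym s t) (eq_sym k0 t) => /and3P[/and3P[_ /negPf-> _] /andP[/negPf->]].
    exact: set2_inj.
  rewrite big1 // => l _; case: eqP => // ec; case/negP: nk; apply/eqP.
  move/setP: ec => /(_ [set s; k]); rewrite !inE eqxx => /orP[]/eqP; first exact: set2_inj.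
  move/setP/(_ s); rewrite !inE eqxx; move: u4 => /=.
  by rewrite !inE !negb_or => /and3P[/and3P[_ /negPf-> /negPf->]].
have [v [v' [w [w' eS]]]] := square_cellP S.
move: nz; rewrite (crossings_square eS) crossings4 mulf_eq0 negb_or => /andP[_].
have step_case a b : step a b s t = 0 \/ (a = s /\ b = t) \/ (a = t /\ b = s).
  case: (boolP [|| (a == s) && (b == t) | (a == t) && (b == s)]) => [|/step0 ->]; last by left.
  by case/orP=> /andP[/eqP-> /eqP->]; right; [left|right].
case: (step_case v w) => [->|[] [<- <-] _]; last first.
- by exists w', v'; rewrite eS cellC.
- by exists v', w'; rewrite eS.
case: (step_case w v') => [->|[] [<- <-] _]; last first.
- by exists v, w'; rewrite eS cellNl.
- by exists w', v; rewrite eS cellC cellNr.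
case: (step_case v' w') => [->|[] [<- <-] _]; last first.
- by exists w, v; rewrite eS cellC cellNl cellNr.
- by exists v, w; rewrite eS cellNl cellNr.
case: (step_case w' v) => [->|[] [<- <-] _]; last first.
- by exists v', w; rewrite eS cellNr.
- by exists w, v'; rewrite eS cellC cellNl.
by rewrite !addr0 eqxx.
Qed.

Lemma boundary_eq0P Z : boundary Z = 0 <-> forall s t, boundary_at Z s t = 0.
Proof.
split=> [bZ s t|bZ]; last first.
  apply/ffunP => g; rewrite !ffunE; case: (enum _) => [|v [|w [|]]];
    first [exact: bZ | by rewrite big1 // => S _; rewrite mulr0].
have [/existsP[k /existsP[l sq]]|no] := boolP [exists k, exists l, is_square p (cell s k t l)].
  have nst : s != t.
    by have := square_uniq sq; rewrite /= !inE !negb_or -!andbA => /and3P[].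
  move/ffunP: bZ => /(_ (exist (fun g => is_true (is_antipodal_edge p g)) _ (square_antipodal_edge sq))); rewrite !ffunE /=.
  case: (enum_set2 nst) => -> //; rewrite /boundary_at => bZ.
  by apply/eqP; rewrite -oppr_eq0 -sumrN -[X in _ == X]bZ; apply/eqP; apply: eq_bigr => S _;
    rewrite crossingsN mulrN opprK.
rewrite boundary_at_coef big1 // => k _; rewrite big1 // => l _.
apply/eqP/negPn/negP => /coef_neq0 sq; case/existsP: no; exists k.
by apply/existsP; exists l.
Qed.

Lemma oriented_cellE S v v' w w' : oriented_cell p v v' w w' S =
  (val S == cell v v' w w')%:R * crossings (attaching_cycle (val S)) v w.
Proof. by rewrite ffunE; case: eqP => _; rewrite ?mul1r ?mul0r. Qed.

End OrientedCoefficients.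

(** * Faces and supporting functionals *)

Section SupportingFunctionals.
Variables (R : realType) (I : finType) (p : I -> 'rV[R]_3).
Implicit Types (c z : 'rV[R]_3) (A e f : {set I}) (i j k v w : I).

Lemma dotD c z z' : dot c (z + z') = dot c z + dot c z'.
Proof. by rewrite /dot -big_split; apply: eq_bigr => k _; rewrite mxE mulrDr. Qed.

Lemma dotZ c (r : R) z : dot c (r *: z) = r * dot c z.
Proof. by rewrite /dot mulr_sumr; apply: eq_bigr => k _; rewrite mxE mulrCA. Qed.

Lemma dotB c z z' : dot c (z - z') = dot c z - dot c z'.
Proof. by rewrite dotD -scaleN1r dotZ mulN1r. Qed.

Lemma dotNl c z : dot (- c) z = - dot c z.
Proof. by rewrite /dot -sumrN; apply: eq_bigr => k _; rewrite mxE mulNr. Qed.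

Lemma dot_comb c A (t : I -> R) :
  dot c (\sum_(i in A) t i *: p i) = \sum_(i in A) t i * dot c (p i).
Proof.
rewrite (big_morph (dot c) (dotD c) (id1 := 0)); last first.
  by rewrite /dot big1 // => k _; rewrite mxE mulr0.
by apply: eq_bigr => i _; rewrite dotZ.
Qed.

Lemma hull_mem A i : i \in A -> hull p A (p i).
Proof.
move=> Ai; exists (fun j => (j == i)%:R); split=> [j||]; first by rewrite ler0n.
- by rewrite (bigD1 i) //= eqxx big1 ?addr0 // => j /andP[_ /negPf->].
- rewrite (bigD1 i) //= eqxx scale1r big1 ?addr0 // => j /andP[_ /negPf->].
  by rewrite scale0r.
Qed.

Lemma hull_le c A (M : R) z :
  (forall i, i \in A -> dot c (p i) <= M) -> hull p A z -> dot c z <= M.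
Proof.
move=> cM [t [t0 t1 ->]]; rewrite dot_comb -[leRHS]mul1r -t1 mulr_suml.
by apply: ler_sum => i Ai; rewrite ler_wpM2l // cM.
Qed.

Lemma hull_eq c A (M : R) z :
  (forall i, i \in A -> dot c (p i) = M) -> hull p A z -> dot c z = M.
Proof.
move=> cM [t [t0 t1 ->]]; rewrite dot_comb -[RHS]mul1r -t1 mulr_suml.
by apply: eq_bigr => i Ai; rewrite cM.
Qed.

Lemma hull_lt c A (M : R) z :
  (forall i, i \in A -> dot c (p i) < M) -> hull p A z -> dot c z < M.
Proof.
move=> cM [t [t0 t1 ->]]; rewrite dot_comb lt_neqAle; apply/andP; split; last first.
  rewrite -[leRHS]mul1r -t1 mulr_suml.
  by apply: ler_sum => i Ai; rewrite ler_wpM2l // ltW // cM.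
apply/eqP => e0; have : \sum_(i in A) t i * (M - dot c (p i)) = 0.
  under eq_bigr do rewrite mulrBr.
  by rewrite sumrB -mulr_suml t1 e0 mul1r subrr.
move/eqP; rewrite psumr_eq0 => [/allP h|i Ai]; last by rewrite mulr_ge0 // subr_ge0 ltW // cM.
have : \sum_(i in A) t i = 0.
  apply: big1 => i Ai; have := h i (mem_index_enum _); rewrite Ai mulf_eq0 => /orP[/eqP//|].
  by rewrite subr_eq0 gt_eqF // cM.
by rewrite t1 => /eqP; rewrite oner_eq0.
Qed.

Lemma hull_sub A z : hull p A z -> polytope p z.
Proof.
move=> [t [t0 t1 ->]]; exists (fun i => if i \in A then t i else 0); split=> [i||].
- by case: ifP.
- by rewrite -t1 [RHS]big_mkcond; apply: eq_bigl => i; rewrite inE.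
- rewrite big_mkcond; apply: eq_big => i; rewrite ?inE // => _.
  by case: ifP => //; rewrite scale0r.
Qed.

Definition exposed A := exists c, exists M : R,
  (forall i, i \in A -> dot c (p i) = M) /\ (forall i, i \notin A -> dot c (p i) < M).

Lemma exposed_face A : A != finset.set0 -> exposed A -> is_face p (hull p A).
Proof.
move=> /finset.set0Pn[i0 Ai0] [c [M [cA cnA]]]; exists c.
have cM i : dot c (p i) <= M.
  by have [/cA->//|/cnA/ltW] := boolP (i \in A).
apply/seteqP; split=> [z hz|z [[t [t0 t1 ->]] hmax]].
  split; first exact: hull_sub hz.
  by move=> z' hz'; rewrite (hull_eq cA hz); apply: hull_le hz'.
 have := hmax _ (hull_sub (hull_mem Ai0)).
rewrite (cA _ Ai0) dot_comb => hM.
have : \sum_(i in [set: I]) t i * (M - dot c (p i)) = 0.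
  apply/eqP; rewrite eq_le; apply/andP; split; last first.
    by apply: sumr_ge0 => i _; rewrite mulr_ge0 // subr_ge0.
  by under eq_bigr do rewrite mulrBr; rewrite sumrB -mulr_suml t1 mul1r subr_le0.
move/eqP; rewrite psumr_eq0 => [/allP h|i Ai]; last by rewrite mulr_ge0 // subr_ge0.
have t_out i : i \notin A -> t i = 0.
  move=> nAi; have := h i (mem_index_enum _); rewrite inE mulf_eq0 => /orP[/eqP//|].
  by rewrite subr_eq0 gt_eqF // cnA.
exists t; split=> //.
  rewrite -t1 [LHS]big_mkcond; apply: eq_big => i; rewrite ?inE // => _.
  by case: ifPn => // /t_out.
rewrite [RHS]big_mkcond; apply: eq_big => i; rewrite ?inE // => _.
by case: ifPn => // /t_out->; rewrite scale0r.
Qed.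

Lemma face_exposed A : A != finset.set0 -> (forall k, k \notin A -> ~ hull p A (p k)) ->
  is_face p (hull p A) -> exposed A.
Proof.
move=> /finset.set0Pn[i0 Ai0] nh [c hc]; exists c, (dot c (p i0)).
have hmax i : i \in A -> forall z', polytope p z' -> dot c z' <= dot c (p i).
  by move=> Ai; have := hull_mem Ai; rewrite hc => -[].
have mem i : polytope p (p i) by apply: (hull_sub (A := [set: I])); apply: hull_mem; rewrite inE.
split=> i Ai.
  by apply/eqP; rewrite eq_le; apply/andP; split; apply: hmax.
rewrite lt_neqAle hmax // andbT; apply/eqP => ei; apply: (nh _ Ai).
by rewrite hc; split=> // z' hz'; rewrite ei; apply: hmax.
Qed.

Lemma vertex_exposed i : injective p -> is_vertex p i -> exposed [set i].
Proof.
move=> injp /asboolP; apply: face_exposed => [|k]; first by apply/finset.set0Pn; exists i; rewrite inE.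
rewrite inE => nki [t [_ + e]]; move: e; rewrite !big_set1 => e t1.
by move: e; rewrite t1 scale1r => /injp /eqP; rewrite (negPf nki).
Qed.

Lemma exposed_vertex i : exposed [set i] -> is_vertex p i.
Proof.
by move=> ei; apply/asboolP; apply: exposed_face => //; apply/finset.set0Pn; exists i; rewrite inE.
Qed.

Lemma is_edgeP v w : (forall i, exposed [set i]) ->
  is_edge p [set v; w] <-> v != w /\ exposed [set v; w].
Proof.
move=> vert; have ne0 : [set v; w] != finset.set0 by apply/finset.set0Pn; exists v; rewrite !inE eqxx.
rewrite /is_edge cards2 eqSS; split=> [/andP[vw /asboolP ef]|[-> ee]]; last first.
  by apply/asboolP; apply: exposed_face ee.
split; first by case: (v == w) vw.
apply: face_exposed ef => // k nk hk; have [c [M [ck cnk]]] := vert k.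
have : dot c (p k) < M.
  by apply: (hull_lt _ hk) => i ei; apply: cnk; rewrite inE; apply: contraNneq nk => <-.
by rewrite ck ?inE // ltxx.
Qed.

Lemma midpoint2 v w : v != w -> midpoint p [set v; w] = 2^-1 *: (p v + p w).
Proof. by move=> vw; rewrite /midpoint big_setU1 ?inE //= big_set1. Qed.

Lemma midpoint_mem v w : v != w -> hull p [set v; w] (midpoint p [set v; w]).
Proof.
move=> vw; exists (fun=> 2^-1); split=> [i||].
- by rewrite invr_ge0 ler0n.
- by rewrite big_setU1 ?inE //= big_set1 -div1r -splitr.
- by rewrite midpoint2 // big_setU1 ?inE //= big_set1 scalerDr.
Qed.

Definition opposite v v' w w' := exists c, exists a b : R,
  [/\ c != 0, (dot c (p v) = a) * (dot c (p v') = a),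
      (dot c (p w) = b) * (dot c (p w') = b)
    & forall i, a <= dot c (p i) <= b].

Lemma antipodal_midpoints v v' w w' : v != v' -> w != w' ->
  antipodal p (midpoint p [set v; v']) (midpoint p [set w; w'])
  <-> opposite v v' w w'.
Proof.
move=> nv nw; split=> [[_ _ [c [a [b [c0 ea eb cab]]]]]|[c [a [b [c0 ea eb cab]]]]].
  have mem i : polytope p (p i) by apply: (hull_sub (A := [set: I])); apply: hull_mem; rewrite inE.
  exists c, a, b; move: ea eb; rewrite !midpoint2 // !dotZ !dotD => ea eb.
  have /andP[h1 h2] := cab _ (mem v); have /andP[h3 h4] := cab _ (mem v').
  have /andP[h5 h6] := cab _ (mem w); have /andP[h7 h8] := cab _ (mem w').
  by split=> [//|||i]; [split; lra|split; lra|apply: cab].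
split; try by apply: hull_sub; apply: midpoint_mem.
exists c, a, b; split=> //.
- by apply: hull_eq (midpoint_mem nv) => i; rewrite !inE => /orP[]/eqP->; rewrite ea.
- by apply: hull_eq (midpoint_mem nw) => i; rewrite !inE => /orP[]/eqP->; rewrite eb.
- move=> z hz; rewrite (hull_le _ hz) ?andbT; last by move=> i _; case/andP: (cab i).
  rewrite -lerN2 -dotNl; apply: hull_le hz => i _.
  by rewrite dotNl lerN2; case/andP: (cab i).
Qed.

Lemma oppositeC v v' w w' : opposite v v' w w' -> opposite w w' v v'.
Proof.
move=> [c [a [b [c0 ea eb cab]]]]; exists (- c), (- b), (- a); split.
- by rewrite oppr_eq0.
- by rewrite !dotNl !eb.
- by rewrite !dotNl !ea.
- by move=> i; rewrite dotNl !lerN2 andbC.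
Qed.

Hypothesis full_dim : forall c, (forall i j, dot c (p i) = dot c (p j)) -> c = 0.
Hypothesis vertices : forall i, exposed [set i].

Lemma opposite_lt c (a b : R) v : c != 0 -> dot c (p v) = a ->
  (forall i, a <= dot c (p i) <= b) -> a < b.
Proof.
move=> c0 ea cab; have /andP[h1 h2] := cab v.
rewrite lt_neqAle (le_trans h1 h2) andbT; apply: contraNneq c0 => eab.
apply/eqP/full_dim => i j; have := cab i; have := cab j.
by rewrite eab => /le_anti <- /le_anti <-.
Qed.

Lemma is_squareP v v' w w' : is_square p (cell v v' w w') <->
  [/\ is_edge p [set v; v'], is_edge p [set w; w'] & opposite v v' w w'].
Proof.
split.
  move=> /existsP[e /existsP[f /and5P[/eqP ec nef ee ef /asboolP ant]]].
  have [[E F]|[E F]] : (e = [set v; v'] /\ f = [set w; w']) \/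
                       (f = [set v; v'] /\ e = [set w; w']).
  - have : e \in cell v v' w w' by rewrite ec !inE eqxx.
    have : f \in cell v v' w w' by rewrite ec !inE eqxx orbT.
    rewrite !inE => /orP[]/eqP Ef /orP[]/eqP Ee; subst e f; last 2 first.
    + by left.
    + by rewrite eqxx in nef.
    + by rewrite eqxx in nef.
    + by right.
  - subst e f; split=> //; move/is_edgeP: ee => /(_ vertices)[n1 _].
    by move/is_edgeP: ef => /(_ vertices)[n2 _]; apply/antipodal_midpoints.
  - subst e f; split=> //; move/is_edgeP: ee => /(_ vertices)[n1 _].
    by move/is_edgeP: ef => /(_ vertices)[n2 _]; apply/oppositeC/antipodal_midpoints.
move=> [ee ef op]; apply/existsP; exists [set v; v']; apply/existsP; exists [set w; w'].
have [n1 _] := (is_edgeP _ _ vertices).1 ee; have [n2 _] := (is_edgeP _ _ vertices).1 ef.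
apply/and5P; split=> //; last by apply/asboolP/antipodal_midpoints.
have [c [a [b [c0 ea eb cab]]]] := op; have ab := opposite_lt c0 ea.1 cab.
apply/eqP => /setP/(_ v); rewrite !inE eqxx /= => /esym/orP[]/eqP ev.
  by move: ab; rewrite -(ea.1) ev eb ltxx.
by move: ab; rewrite -(ea.1) ev eb ltxx.
Qed.

Lemma square_uniq v v' w w' : is_square p (cell v v' w w') -> uniq [:: v; v'; w; w'].
Proof.
move=> /is_squareP[ee ef [c [a [b [c0 ea eb cab]]]]]; have ab := opposite_lt c0 ea.1 cab.
have [n1 _] := (is_edgeP _ _ vertices).1 ee; have [n2 _] := (is_edgeP _ _ vertices).1 ef.
have ne x y : dot c (p x) = a -> dot c (p y) = b -> x != y.
  by move=> xa yb; apply: contraTneq ab => xy; rewrite -xa -yb xy ltxx.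
by rewrite /= !inE !negb_or n1 n2 !ne ?ea ?eb.
Qed.

Lemma square_antipodal_edge v v' w w' :
  is_square p (cell v v' w w') -> is_antipodal_edge p [set v; w].
Proof.
move=> sq; have := square_uniq sq; move/is_squareP: sq => [_ _ [c [a [b [c0 ea eb cab]]]]].
rewrite /= !inE !negb_or => /andP[/and3P[_ vw _] _].
apply/existsP; exists v; apply/existsP; exists w; rewrite eqxx vw !exposed_vertex //=.
have mem i : polytope p (p i) by apply: (hull_sub (A := [set: I])); apply: hull_mem; rewrite inE.
apply/asboolP; split=> //; exists c, a, b; split; rewrite ?ea ?eb // => z hz.
rewrite (hull_le _ hz) ?andbT; last by move=> i _; case/andP: (cab i).
rewrite -lerN2 -dotNl; apply: hull_le hz => i _.
by rewrite dotNl lerN2; case/andP: (cab i).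
Qed.

End SupportingFunctionals.

(** * Plane convex polygons *)

Section PlanarPolygon.
Variables (R : realFieldType) (I : finType) (X Y : I -> R).
Implicit Types (i j k o u v w x y z : I).

(* Twice the signed area of the triangle ijk. *)
Definition area2 i j k : R :=
  (X j - X i) * (Y k - Y i) - (Y j - Y i) * (X k - X i).

Lemma area2C i j k : area2 i k j = - area2 i j k.
Proof. by rewrite /area2; ring. Qed.

Lemma area2_rot i j k : area2 j k i = area2 i j k.
Proof. by rewrite /area2; ring. Qed.

Lemma area2_rev i j k : area2 j i k = - area2 i j k.
Proof. by rewrite /area2; ring. Qed.

Lemma area2_iji i j : area2 i j i = 0.
Proof. by rewrite /area2; ring. Qed.

Lemma area2_ijj i j : area2 i j j = 0.
Proof. by rewrite /area2; ring. Qed.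

Definition cross u v x y : R := (X v - X u) * (Y y - Y x) - (Y v - Y u) * (X y - X x).

Lemma cross_area2 u v x y : cross u v x y = area2 u v y - area2 u v x.
Proof. by rewrite /cross /area2; ring. Qed.

Lemma crossNl u v x y : cross v u x y = - cross u v x y.
Proof. by rewrite /cross; ring. Qed.

Lemma crossNr u v x y : cross u v y x = - cross u v x y.
Proof. by rewrite /cross; ring. Qed.

Lemma crossC u v x y : cross x y u v = - cross u v x y.
Proof. by rewrite /cross; ring. Qed.

(* The edges of the polygon, directed counterclockwise. *)
Definition ccw x y := (x != y) && [forall k, (k != x) ==> (k != y) ==> (0 < area2 x y k)].

Lemma ccwP x y :
  reflect (x != y /\ forall k, k != x -> k != y -> 0 < area2 x y k) (ccw x y).
Proof.
apply: (iffP andP) => -[nxy h]; split=> //.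
  by move=> k nx ny; have := forallP h k; rewrite nx ny.
by apply/forallP => k; apply/implyP => nx; apply/implyP => ny; apply: h.
Qed.

Lemma ccw_area2_ge0 x y k : ccw x y -> 0 <= area2 x y k.
Proof.
case/ccwP=> _ h; have [->|nx] := eqVneq k x; first by rewrite area2_iji.
by have [->|ny] := eqVneq k y; [rewrite area2_ijj | rewrite ltW // h].
Qed.

Lemma ccw_area2_gt0 x y k : ccw x y -> area2 x y k != 0 -> 0 < area2 x y k.
Proof. by move=> xy nz; rewrite lt_neqAle eq_sym nz ccw_area2_ge0. Qed.

Lemma ccw_inj_r x y y' : ccw x y -> ccw x y' -> y = y'.
Proof.
case/ccwP=> nxy h /ccwP[nxy' h']; apply/eqP/negPn/negP => nyy'.
have h1 : 0 < area2 x y y' by apply: h; rewrite eq_sym.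
have h2 : 0 < area2 x y' y by apply: h'; rewrite // eq_sym.
by move: h1 h2; rewrite area2C; lra.
Qed.

Lemma ccw_inj_l x x' y : ccw x y -> ccw x' y -> x = x'.
Proof.
case/ccwP=> nxy h /ccwP[nxy' h']; apply/eqP/negPn/negP => nxx'.
have h1 : 0 < area2 x y x' by apply: h; rewrite // eq_sym.
have h2 : 0 < area2 x' y x by apply: h'; rewrite //.
by move: h1 h2; rewrite -[area2 x y x']area2_rot area2_rev -area2_rot; lra.
Qed.

Hypothesis strict_vertex : forall i, exists al be : R,
  forall j, j != i -> al * X j + be * Y j < al * X i + be * Y i.
Hypothesis third : forall x y, exists k, (k != x) && (k != y).

Lemma area2_neq0 i j k : i != j -> i != k -> j != k -> area2 i j k != 0.
Proof.
move=> nij nik njk; apply/eqP => a0.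
have [a1 [b1 h1]] := strict_vertex i; have [a2 [b2 h2]] := strict_vertex j.
have [a3 [b3 h3]] := strict_vertex k.
have := h1 j; have := h1 k; have := h2 i; have := h2 k; have := h3 i; have := h3 j.
rewrite ![j == i]eq_sym ![k == i]eq_sym ![k == j]eq_sym => /(_ njk) g1 /(_ nik) g2.
move=> /(_ njk) g3 /(_ nij) g4 /(_ nik) g5 /(_ nij) g6.
pose L a b z : R := a * (X z - X i) + b * (Y z - Y i).
have prop a b a' b' : L a b j * L a' b' k = L a b k * L a' b' j.
  apply/eqP; rewrite -subr_eq0; apply/eqP.
  have -> : L a b j * L a' b' k - L a b k * L a' b' j = (a * b' - b * a') * area2 i j k.
    by rewrite /L /area2; ring.
  by rewrite a0 mulr0.
have p12 := prop a1 b1 a2 b2; have p23 := prop a2 b2 a3 b3.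
have l1j : L a1 b1 j < 0 by rewrite /L; lra.
have l1k : L a1 b1 k < 0 by rewrite /L; lra.
have l2j : 0 < L a2 b2 j by rewrite /L; lra.
have l2k : L a2 b2 k < L a2 b2 j by rewrite /L; lra.
have l3k : 0 < L a3 b3 k by rewrite /L; lra.
have l3j : L a3 b3 j < L a3 b3 k by rewrite /L; lra.
have l2k0 : 0 < L a2 b2 k.
  have : L a1 b1 j * L a2 b2 k < 0 by rewrite p12 nmulr_rlt0.
  by rewrite nmulr_rlt0.
have : L a2 b2 k * L a3 b3 j < L a2 b2 j * L a3 b3 k.
  apply: (@lt_trans _ _ (L a2 b2 k * L a3 b3 k)); first by rewrite ltr_pM2l.
  by rewrite ltr_pM2r.
by rewrite p23 ltxx.
Qed.

(* The other points lie in an open half plane bounded by a line through the vertex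
   z, so that they are ordered by the slope at which they are seen from z. *)
Lemma slope_at z : exists s : I -> R, forall j k, j != z -> k != z ->
  (0 < area2 z j k) = (s j < s k).
Proof.
have [a [b h]] := strict_vertex z.
pose wd k := a * (X z - X k) + b * (Y z - Y k); pose ht k := a * (Y k - Y z) - b * (X k - X z).
exists (fun k => - (ht k / wd k)) => j k nj nk.
have wj : 0 < wd j by have := h j nj; rewrite /wd; lra.
have wk : 0 < wd k by have := h k nk; rewrite /wd; lra.
rewrite ltrN2 ltr_pdivrMr // mulrAC ltr_pdivlMr // -[RHS]subr_gt0.
have -> : ht j * wd k - ht k * wd j = (a ^+ 2 + b ^+ 2) * area2 z j k.
  by rewrite /ht /wd /area2; ring.
rewrite pmulr_rgt0 // lt_neqAle addr_ge0 ?sqr_ge0 // andbT eq_sym.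
rewrite paddr_eq0 ?sqr_ge0 // !sqrf_eq0; apply/negP => /andP[/eqP a0 /eqP b0].
by move: wj; rewrite /wd a0 b0 !mul0r addr0 ltxx.
Qed.

Lemma ccw_out x : exists y, ccw x y.
Proof.
have [s hs] := slope_at x; have [k0 /andP[nk0 _]] := third x x.
pose y := [arg min_(i < k0 | i != x) s i]%O; exists y.
have [] : (y != x) /\ forall j, j != x -> s y <= s j.
  by rewrite /y; case: arg_minP => // i ni hi; split.
move=> ny hy; apply/ccwP; split; first by rewrite eq_sym.
move=> k nkx nky; have nz : area2 x y k != 0 by apply: area2_neq0; rewrite // eq_sym.
rewrite lt_neqAle eq_sym nz /=.
rewrite leNgt; apply/negP; rewrite -oppr_gt0 -area2C hs // => sky.
by have := hy k nkx; rewrite leNgt sky.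
Qed.

Lemma ccw_asym x y : ccw x y -> ccw y x = false.
Proof.
case/ccwP=> nxy h; apply/negP => /ccwP[_ h']; have [k /andP[kx ky]] := third x y.
by have := h k kx ky; have := h' k ky kx; rewrite area2_rev; lra.
Qed.

(* Seen from z, the slope strictly increases along the counterclockwise edges
   missing z, so that following them must lead to z. *)
Lemma ccw_connected (A : {set I}) z0 : z0 \in A ->
  (forall x y, x \in A -> ccw x y -> y \in A) -> forall z, z \in A.
Proof.
move=> Az0 clA z; apply/negPn/negP => nAz.
have [s hs] := slope_at z.
have nz x : x \in A -> x != z by move=> Ax; apply: contraNneq nAz => <-.
pose y := [arg max_(i > z0 in A) s i]%O.
have [Ay hy] : (y \in A) /\ forall j, j \in A -> s j <= s y.
  by rewrite /y; case: arg_maxP => // i ni hi; split.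
have [y' yy'] := ccw_out y; have Ay' := clA _ _ Ay yy'.
have [_ /(_ z)] := ccwP _ _ yy'; rewrite ![z == _]eq_sym !nz // -area2_rot -area2_rot.
move=> /(_ isT isT); rewrite hs ?nz // => lt.
by have := hy _ Ay'; rewrite leNgt lt.
Qed.

Lemma ccw_plane_edge x y (al be : R) : x != y ->
  al * X x + be * Y x = al * X y + be * Y y ->
  (forall k, k != x -> k != y -> al * X k + be * Y k < al * X x + be * Y x) ->
  ccw x y || ccw y x.
Proof.
move=> nxy exy hk; pose m := be * (X y - X x) - al * (Y y - Y x).
have hm k : m * (al * (X k - X x) + be * (Y k - Y x)) = - (al ^+ 2 + be ^+ 2) * - area2 x y k.
  have -> : - (al ^+ 2 + be ^+ 2) * - area2 x y k = m * (al * (X k - X x) + be * (Y k - Y x))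
    + (al * (X y - X x) + be * (Y y - Y x)) * (al * (Y k - Y x) - be * (X k - X x)).
    by rewrite /area2 /m; ring.
  have -> : al * (X y - X x) + be * (Y y - Y x) = 0 by lra.
  by rewrite mul0r addr0.
have [k0 /andP[k0x k0y]] := third x y.
have N0 : 0 < al ^+ 2 + be ^+ 2.
  rewrite lt_neqAle addr_ge0 ?sqr_ge0 // andbT eq_sym paddr_eq0 ?sqr_ge0 // !sqrf_eq0.
  apply/negP => /andP[/eqP a0 /eqP b0]; have := hk k0 k0x k0y.
  by rewrite a0 b0 !mul0r ltxx.
have hk' k : k != x -> k != y -> al * (X k - X x) + be * (Y k - Y x) < 0.
  by move=> kx ky; have := hk k kx ky; lra.
case: (ltgtP m 0) => m0.
- apply/orP; left; apply/ccwP; split=> // k kx ky.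
  have : 0 < m * (al * (X k - X x) + be * (Y k - Y x)) by rewrite nmulr_rgt0 ?hk'.
  by rewrite hm mulrNN pmulr_rgt0.
- apply/orP; right; apply/ccwP; split=> [|k ky kx]; first by rewrite eq_sym.
  have : m * (al * (X k - X x) + be * (Y k - Y x)) < 0 by rewrite pmulr_rlt0 ?hk'.
  by rewrite hm mulrNN pmulr_rlt0 // (area2_rev x y) oppr_gt0.
- have := hm k0; rewrite m0 mul0r mulrNN => /esym/eqP; rewrite mulf_eq0 gt_eqF //=.
  by rewrite (negPf (area2_neq0 _ _ _)) // eq_sym.
Qed.

Lemma top_of_parallel x y u v : ccw x y -> ccw u v || ccw v u ->
  [set u; v] != [set x; y] -> cross x y u v = 0 ->
  [/\ uniq [:: x; y; u; v], area2 x y u = area2 x y v &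
      forall k, area2 x y k <= area2 x y u].
Proof.
move=> xy uv nuv par.
have nuv' : u != v by case/orP: uv => /ccwP[] //; rewrite eq_sym.
have [nxy _] := ccwP _ _ xy.
have euv : area2 x y u = area2 x y v.
  by apply/esym/eqP; rewrite -subr_eq0 -cross_area2 par.
have out w w' : w != w' -> [set w; w'] != [set x; y] -> area2 x y w = area2 x y w' ->
    (w != x) && (w != y).
  move=> nww' nset e; rewrite -negb_or; apply/negP => wxy.
  have w0 : area2 x y w = 0 by case/orP: wxy => /eqP->; rewrite ?area2_iji ?area2_ijj.
  have : area2 x y w' != 0; last by rewrite -e w0 eqxx.
  apply: area2_neq0 => //; apply/eqP => ew; case/eqP: nset; rewrite -ew.
    by case/orP: wxy nww' => /eqP->; rewrite -ew ?eqxx // finset.setUC.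
  by case/orP: wxy nww' => /eqP->; rewrite -ew ?eqxx.
have /andP[ux uy] := out _ _ nuv' nuv euv.
have /andP[vx vy] : (v != x) && (v != y).
  by apply: (out v u _ _ (esym euv)); [rewrite eq_sym | rewrite finset.setUC].
split=> [|//|k]; first by rewrite /= !inE !negb_or nxy nuv' ![x == _]eq_sym ![y == _]eq_sym ux vx uy vy.
have id w w' : cross x y u w * cross u v u w' = cross x y u w' * cross u v u w.
  apply/eqP; rewrite -subr_eq0; apply/eqP.
  have -> : cross x y u w * cross u v u w' - cross x y u w' * cross u v u w
    = cross x y u v * area2 u w w' by rewrite /cross /area2; ring.
  by rewrite par mul0r.
have [->|ku] := eqVneq k u; first by rewrite lexx.
have [->|kv] := eqVneq k v; first by rewrite euv.
have := id k x; rewrite -subr_le0 -cross_area2.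
have c0 : cross x y u x < 0.
  rewrite cross_area2 area2_iji sub0r oppr_lt0; apply: ccw_area2_gt0 => //.
  by apply: area2_neq0 => //; rewrite eq_sym.
have ca w : cross u v u w = area2 u v w by rewrite /cross /area2.
rewrite !ca => e.
case/orP: uv => /ccwP[_ h].
  have hx : 0 < area2 u v x by apply: h; rewrite eq_sym.
  have hk : 0 < area2 u v k by apply: h.
  have : cross x y u k * area2 u v x < 0 by rewrite e nmulr_rlt0.
  by rewrite pmulr_llt0 // => /ltW.
have hx : 0 < area2 v u x by apply: h; rewrite eq_sym.
have hk : 0 < area2 v u k by apply: h.
have : 0 < cross x y u k * area2 u v x.
  by rewrite e nmulr_rgt0 //; move: hk; rewrite area2_rev oppr_gt0.
by move: hx; rewrite area2_rev oppr_gt0 => hx; rewrite nmulr_lgt0 // => /ltW.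
Qed.

Lemma parallel_of_top x y u v : ccw x y -> u != v ->
  (forall k, area2 x y k <= area2 x y u) -> area2 x y u = area2 x y v ->
  ccw u v || ccw v u.
Proof.
move=> xy nuv top euv.
have [nxy hxy] := ccwP _ _ xy.
have [k0 /andP[k0x k0y]] := third x y.
have u0 : 0 < area2 x y u by apply: lt_le_trans (top k0); apply: hxy.
have par : cross x y u v = 0 by rewrite cross_area2 euv subrr.
have ca w : cross u v u w = area2 u v w by rewrite /cross /area2.
have id w : cross x y u w * area2 u v x = - area2 x y u * area2 u v w.
  apply/eqP; rewrite -subr_eq0; apply/eqP.
  have -> : cross x y u w * area2 u v x - - area2 x y u * area2 u v w
    = cross x y u v * area2 u w x by rewrite /cross /area2; ring.
  by rewrite par mul0r.
have ux : u != x by apply: contraTneq u0 => ->; rewrite area2_iji ltxx.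
have vx : v != x by move: u0; rewrite euv; apply: contraTneq => ->; rewrite area2_iji ltxx.
have neg k : k != u -> k != v -> cross x y u k < 0.
  move=> ku kv; rewrite lt_neqAle cross_area2 subr_le0 top andbT -cross_area2.
  apply/eqP => c0; have := id k; rewrite c0 mul0r => /esym/eqP.
  rewrite mulf_eq0 oppr_eq0 gt_eqF //=; by rewrite (negPf (area2_neq0 _ _ _)) // eq_sym.
have a0 : area2 u v x != 0 by apply: area2_neq0.
have pos k : k != u -> k != v -> 0 < area2 u v x * area2 u v k.
  move=> ku kv; have := id k => e; have : 0 < area2 x y u * (area2 u v x * area2 u v k).
    have -> : area2 x y u * (area2 u v x * area2 u v k) = area2 u v x ^+ 2 * - cross x y u k.
      by rewrite mulrCA mulrN expr2 -mulrA [area2 u v x * cross _ _ _ _]mulrC e; ring.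
    by rewrite mulr_gt0 ?oppr_gt0 ?neg // lt_neqAle eq_sym sqr_ge0 sqrf_eq0 a0.
  by rewrite pmulr_rgt0.
case: (ltgtP (area2 u v x) 0) a0 => // s _.
- apply/orP; right; apply/ccwP; split=> [|k kv ku]; first by rewrite eq_sym.
  by have := pos k ku kv; rewrite (area2_rev u v) oppr_gt0 nmulr_rgt0.
- apply/orP; left; apply/ccwP; split=> // k ku kv.
  by have := pos k ku kv; rewrite pmulr_rgt0.
Qed.

(* In a trapezoid x, y, u, v, the side xv is antipodal only with respect to the
   direction normal to the parallel edges. *)
Lemma trapezoid_side x y u v (al be : R) : ccw x y -> ccw u v ->
  [set u; v] != [set x; y] -> cross x y u v = 0 ->
  (forall k, al * X x + be * Y x <= al * X k + be * Y k <= al * X v + be * Y v) ->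
  al * X y + be * Y y = al * X x + be * Y x /\ al * X u + be * Y u = al * X v + be * Y v.
Proof.
move=> xy uv nuv par h.
have [] := top_of_parallel xy _ nuv par; first by rewrite uv.
rewrite /= !inE !negb_or => /and3P[/and3P[nxy nxu nxv] /andP[nyu nyv] /andP[nuv' _]] _ _.
have cu : 0 < area2 x y u by apply: ccw_area2_gt0 => //; apply: area2_neq0.
have cx : 0 < area2 u v x by apply: ccw_area2_gt0 => //; apply: area2_neq0; rewrite // eq_sym.
have /andP[hy _] := h y; have /andP[_ hu] := h u.
have d0 : 0 <= al * (X y - X x) + be * (Y y - Y x) by lra.
have e0 : 0 <= al * (X v - X u) + be * (Y v - Y u) by lra.
have : (al * (X y - X x) + be * (Y y - Y x)) * area2 u v x
     + (al * (X v - X u) + be * (Y v - Y u)) * area2 x y u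
   = cross x y u v * (al * (X u - X x) + be * (Y u - Y x)).
  by rewrite /area2 /cross; ring.
rewrite par !mul0r => /eqP; rewrite paddr_eq0 ?mulr_ge0 // 1?ltW // !mulf_eq0.
by rewrite (gt_eqF cu) (gt_eqF cx) !orbF => /andP[/eqP e1 /eqP e2]; split; lra.
Qed.

Lemma level_edge x y k w (al be : R) : x != y -> k != x ->
  al * X y + be * Y y = al * X x + be * Y x -> al * X k + be * Y k = al * X x + be * Y x ->
  al * X w + be * Y w != al * X x + be * Y x -> k = y.
Proof.
move=> nxy kx ey ek nw; apply/eqP/negPn/negP => ky.
have : (al * (X w - X x) + be * (Y w - Y x)) * area2 x y k = 0.
  have -> : (al * (X w - X x) + be * (Y w - Y x)) * area2 x y k =
     (al * (X y - X x) + be * (Y y - Y x)) * area2 x w k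
     - (al * (X k - X x) + be * (Y k - Y x)) * area2 x w y by rewrite /area2; ring.
  have -> : al * (X y - X x) + be * (Y y - Y x) = 0 by lra.
  have -> : al * (X k - X x) + be * (Y k - Y x) = 0 by lra.
  by rewrite !mul0r subrr.
move/eqP; rewrite mulf_eq0 (negPf (area2_neq0 _ _ _)) ?orbF //; try by rewrite eq_sym.
move/eqP => e; case/negP: nw; apply/eqP; lra.
Qed.

Lemma top_abs x y w : ccw x y ->
  (forall k, `|area2 x y k| <= `|area2 x y w|) <-> (forall k, area2 x y k <= area2 x y w).
Proof.
by move=> xy; split=> h k; have := h k; rewrite !ger0_norm ?ccw_area2_ge0.
Qed.

Lemma flow_const (V : zmodType) (t : I -> I -> V) :
  (forall x y, t y x = - t x y) -> (forall x y, t x y != 0 -> ccw x y || ccw y x) ->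
  (forall x, \sum_y t x y = 0) ->
  forall x y x' y', ccw x y -> ccw x' y' -> t x y = t x' y'.
Proof.
move=> tN tE t0 x0 y0 x' y' xy0.
have step_flow w x y : ccw w x -> ccw x y -> t x y = t w x.
  move=> wx xy; have nwy : w != y.
    by apply/eqP => e; move: (ccw_asym xy); rewrite -e wx.
  have := t0 x; rewrite (bigD1 y) //= (bigD1 w) //= big1 => [|z /andP[zy zw]].
    by rewrite addr0 (tN w x) => /eqP; rewrite subr_eq0 => /eqP.
  apply/eqP/negPn/negP => /tE /orP[xz|zx].
    by rewrite (ccw_inj_r xz xy) eqxx in zy.
  by rewrite (ccw_inj_l zx wx) eqxx in zw.
pose A := [set x | [forall y, ccw x y ==> (t x y == t x0 y0)]].
have AP x : x \in A -> forall y, ccw x y -> t x y = t x0 y0.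
  by rewrite inE => /forallP h y xy; have := h y; rewrite xy => /eqP.
have PA x : (forall y, ccw x y -> t x y = t x0 y0) -> x \in A.
  by move=> h; rewrite inE; apply/forallP => y; apply/implyP => /h ->.
move=> xy'; apply/esym/AP; last exact: xy'.
apply: (@ccw_connected _ x0); first by apply: PA => y xy; rewrite (ccw_inj_r xy xy0).
by move=> x y Ax xy; apply: PA => z yz; rewrite (step_flow _ _ _ xy yz) (AP _ Ax).
Qed.

Lemma apex_flow_eq0 (C : I -> I -> I -> rat) :
  (forall w x y, C w y x = - C w x y) ->
  (forall w x y, C w x y != 0 ->
     (ccw x y || ccw y x) /\ forall k, `|area2 x y k| <= `|area2 x y w|) ->
  (forall x, \sum_y \sum_w C w x y = 0) ->
  (forall o, \sum_w \sum_x \sum_y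
     ratr (C w x y) * (area2 x y w - area2 x y o) = 0 :> R) ->
  forall x y, \sum_w C w x y = 0.
Proof.
move=> CN CE C0 pairing.
pose t x y := \sum_w C w x y.
have tN x y : t y x = - t x y by rewrite /t -sumrN; apply: eq_bigr => w _.
have tE x y : t x y != 0 -> ccw x y || ccw y x.
  apply: contraR => nE; rewrite /t big1 // => w _.
  by apply/eqP/negPn/negP => /CE[]; rewrite (negPf nE).
have tc := flow_const tN tE C0.
suff tc0 x y : ccw x y -> t x y = 0.
  move=> x y; apply/eqP/negPn/negP => n0; move: (n0); rewrite -/(t x y).
  by case/orP: (tE _ _ n0) => /tc0; [move=> -> | rewrite tN => /eqP; rewrite oppr_eq0 => /eqP->];
    rewrite eqxx.
move=> xy0; pose o := x; have xy := xy0; pose r : R := ratr (t x y).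
pose H x' y' : R := \sum_w ratr (C w x' y') * (area2 x' y' w - area2 x' y' o).
have HC x' y' : H y' x' = H x' y'.
  by apply: eq_bigr => w _; rewrite CN rmorphN /= !(area2_rev x' y'); ring.
have [top topP] : exists top : I -> I -> I, forall x' y' k, area2 x' y' k <= area2 x' y' (top x' y').
  exists (fun x' y' => [arg max_(w > x) area2 x' y' w]%O) => x' y' k.
  by case: arg_maxP => // i _; apply.
have Hccw x' y' : ccw x' y' -> H x' y' = r * (area2 x' y' (top x' y') - area2 x' y' o).
  move=> xy'; rewrite /r (tc _ _ _ _ xy xy') /t rmorph_sum /= mulr_suml.
  apply: eq_bigr => w _; have [->|n0] := eqVneq (C w x' y') 0; first by rewrite rmorph0 !mul0r.
  congr (_ * (_ - _)); apply/eqP; rewrite eq_le topP /=.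
  by have [_ /(top_abs _ xy')] := CE _ _ _ n0; apply.
have H0 x' y' : 0 <= r * H x' y'.
  have [xy'|nxy'] := boolP (ccw x' y').
    by rewrite Hccw // mulrA -expr2 mulr_ge0 ?sqr_ge0 // subr_ge0.
  have [yx'|nyx'] := boolP (ccw y' x').
    by rewrite -HC Hccw // mulrA -expr2 mulr_ge0 ?sqr_ge0 // subr_ge0.
  rewrite /H big1 ?mulr0 // => w _; have [->|n0] := eqVneq (C w x' y') 0.
    by rewrite rmorph0 mul0r.
  by have [] := CE _ _ _ n0; rewrite (negPf nxy') (negPf nyx').
have : \sum_x' \sum_y' r * H x' y' = 0.
  under eq_bigr do rewrite -mulr_sumr; rewrite -mulr_sumr -[X in r * X](_ : 0 = _) ?mulr0 //.
  rewrite -[LHS](pairing o) exchange_big; apply: eq_bigr => x' _; rewrite exchange_big.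
  by apply: eq_bigr.
move/eqP; rewrite psumr_eq0 => [/allP/(_ x (mem_index_enum _))|x' _]; last by apply: sumr_ge0.
rewrite psumr_eq0 => [/allP/(_ y (mem_index_enum _))|//].
rewrite Hccw // mulrA mulf_eq0 -expr2 sqrf_eq0 area2_iji subr0.
have [k /andP[kx ky]] := third x y; have [_ /(_ k kx ky) k0] := ccwP _ _ xy.
by rewrite (gt_eqF (lt_le_trans k0 (topP _ _ _))) orbF fmorph_eq0 => /eqP.
Qed.

End PlanarPolygon.

Lemma big_option (V : zmodType) (I : finType) (F : option I -> V) :
  \sum_o F o = F None + \sum_i F (Some i).
Proof.
rewrite (bigD1 None) //=; congr (_ + _).
rewrite (reindex_omap (@Some I) id) => [|[]//]; apply: eq_bigl => i /=.
by rewrite eqxx.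
Qed.

Lemma antisym_sum (K : comPzRingType) (I : finType) (D : I -> I -> K) (f : I -> K) :
  (forall x y, D y x = - D x y) ->
  2 * (\sum_x \sum_y D x y * f x) = \sum_x \sum_y D x y * (f x - f y).
Proof.
move=> DN; rewrite mulr_natl mulr2n.
rewrite [X in _ + X]exchange_big -big_split; apply: eq_bigr => x _ /=.
by rewrite -big_split; apply: eq_bigr => y _ /=; rewrite DN; ring.
Qed.

(* The area pairing (x, u) |-> area2 o x u on 1-chains, applied to the boundary
   of a 2-chain D: it sees a square cell through the cross product of its two
   edges, hence ignores the squares on two parallel base edges. *)
Lemma area_pairing (R : realFieldType) (I : finType) (X Y : I -> R)
    (D : option I -> option I -> option I -> option I -> R) (o : I) :
  (forall s k t l, D k s t l = - D s k t l) ->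
  (forall s k t l, D s k l t = - D s k t l) ->
  (forall s k t l, D t l s k = - D s k t l) ->
  (forall s t, D s None t None = 0) ->
  (forall x k u l, D (Some x) (Some k) (Some u) (Some l) * cross X Y x k u l = 0) ->
  (forall x u, \sum_k \sum_l D (Some x) k (Some u) l = 0) ->
  \sum_w \sum_x \sum_y
    D None (Some w) (Some x) (Some y) * (area2 X Y x y w - area2 X Y x y o) = 0.
Proof.
move=> Dl Dr DC DNN Dcross D0.
set T := LHS; pose la := area2 X Y o.
pose A := \sum_x \sum_u \sum_k \sum_l D (Some x) (Some k) (Some u) (Some l) * la x u.
pose B1 := \sum_x \sum_u \sum_l D (Some x) None (Some u) (Some l) * la x u.
pose B2 := \sum_x \sum_u \sum_k D (Some x) (Some k) (Some u) None * la x u.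
have sum0 : A + B1 + B2 = 0.
  rewrite /A /B1 /B2 -!big_split /=; apply: big1 => x _.
  rewrite -!big_split /=; apply: big1 => u _.
  transitivity (0 * la x u); last by rewrite mul0r.
  rewrite -[in RHS](D0 x u) big_option big_option DNN add0r.
  under [X in _ = (_ + X) * _]eq_bigr do rewrite big_option.
  rewrite big_split /= !mulrDl !mulr_suml.
  under [X in _ = _ + (_ + X)]eq_bigr do rewrite mulr_suml.
  by rewrite -addrA addrC -addrA.
have A0 : A = 0.
  have -> : A = \sum_u \sum_l \sum_x \sum_k D (Some x) (Some k) (Some u) (Some l) * la x u.
    rewrite /A exchange_big; apply: eq_bigr => u _ /=.
    under eq_bigr => x _ do rewrite exchange_big.
    by rewrite exchange_big.
  suff : 2 * (2 * \sum_u \sum_l \sum_x \sum_k D (Some x) (Some k) (Some u) (Some l) * la x u) = 0.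
    by move/eqP; rewrite !mulf_eq0 pnatr_eq0 /= => /eqP.
  have e u l : 2 * \sum_x \sum_k D (Some x) (Some k) (Some u) (Some l) * la x u =
     \sum_x \sum_k D (Some x) (Some k) (Some u) (Some l) * (la x u - la k u).
    by rewrite (antisym_sum (fun x => la x u)).
  rewrite [2 * \sum_u _]mulr_sumr; under eq_bigr do rewrite mulr_sumr.
  under eq_bigr do under eq_bigr do rewrite e.
  under eq_bigr do rewrite exchange_big; rewrite exchange_big /=.
  rewrite mulr_sumr big1 // => x _.
  under eq_bigr do rewrite exchange_big; rewrite exchange_big /=.
  rewrite mulr_sumr big1 // => k _.
  rewrite (antisym_sum (fun u => la x u - la k u)) // big1 // => u _; rewrite big1 // => l _.
  rewrite -[RHS](Dcross x k u l); congr (_ * _).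
  by rewrite /la /area2 /cross; ring.
have B1T : 2 * B1 = - T.
  rewrite /B1 /T mulr_sumr -sumrN; apply: eq_bigr => x _.
  rewrite antisym_sum // -sumrN; apply: eq_bigr => u _.
  rewrite -sumrN; apply: eq_bigr => l _; rewrite Dl /la /area2; ring.
have B2T : 2 * B2 = - T.
  rewrite /B2 /T exchange_big mulr_sumr -sumrN; apply: eq_bigr => u _ /=.
  rewrite (antisym_sum (fun x => la x u)) // -sumrN; apply: eq_bigr => x _.
  rewrite -sumrN; apply: eq_bigr => k _; rewrite DC Dl /la /area2; ring.
by move: sum0; rewrite A0 add0r => e; lra.
Qed.

(** * Squares of a pyramid *)

Section PyramidCoordinates.
Variables (R : realType) (I : finType) (q : I -> 'rV[R]_3) (a : 'rV[R]_3).

(* X and Y are affine coordinates on the base plane: the functionals restrict to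
   the affine functions of X and Y, with an arbitrary value at the apex. *)
Definition base_coordinates (X Y : I -> R) :=
  [/\ forall al be ga : R, exists c, exists k : R,
        (forall i, dot c (q i) = k + (al * X i + be * Y i)) /\ dot c a = k + ga,
      forall c, exists al be k : R, forall i, dot c (q i) = k + (al * X i + be * Y i),
      forall c, (forall o o', dot c (pyramid q a o) = dot c (pyramid q a o')) -> c = 0,
      forall u v x y, u != v -> x != y ->
        (line_dir q u v = line_dir q x y) <-> cross X Y x y u v = 0
    & forall x y : I, exists k, (k != x) && (k != y)].

Lemma dot_direction c z : (forall i j, dot c (q i) = dot c (q j)) ->
  z \in direction q -> dot c z = 0.
Proof.
move=> cq; rewrite /direction => hz; rewrite (coord_span (X := in_tuple _) hz).
rewrite (big_morph (dot c) (dotD c) (id1 := 0)); last first.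
  by rewrite /dot big1 // => k _; rewrite mxE mulr0.
apply: big1 => i _; rewrite dotZ.
have /mapP[[j k] _ ->] := mem_nth 0 (ltn_ord i).
by rewrite dotB (cq j k) subrr mulr0.
Qed.

Lemma base_coordinates_exist : convex_polygon q -> ~ affine_hull q a ->
  exists X Y, base_coordinates X Y.
Proof.
move=> [injq _ dim2] nq.
have [e1 [e2 [eD fr]]] : exists e1 e2, <<[:: e1; e2]>>%VS = direction q /\ free [:: e1; e2].
  have sz : size (vbasis (direction q)) = 2 by rewrite size_tuple dim2.
  case: (tval _) (vbasisP (direction q)) sz => [|e1 [|e2 [|]]] // /andP[/eqP eD fr] _.
  by exists e1, e2.
have memD i j : q i - q j \in direction q.
  by apply: memv_span; apply/mapP; exists (i, j); rewrite ?mem_enum.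
have [i0 _] : exists i0 : I, true.
  case: (pickP (fun _ : I => true)) => [i0 _|no]; first by exists i0.
  have : direction q = 0%VS.
    apply/eqP; rewrite -subv0; apply/span_subvP => z /mapP[[i j] _ _].
    by have := no i.
  by move=> d0; move: dim2; rewrite d0 dimv0.
pose e3 : 'rV[R]_3 := a - q i0.
have fr3 : free [:: e3; e1; e2].
  by rewrite free_cons fr andbT eD; apply/negP => h; apply: nq; exists i0.
pose b := [tuple e3; e1; e2].
have bas : basis_of fullv b.
  by rewrite basisEfree fr3 subvf /= dimvf /dim /=.
pose X i : R := coord b 1 (q i - q i0); pose Y i : R := coord b 2 (q i - q i0).
have coor i : q i = q i0 + (X i *: e1 + Y i *: e2).
  have := memD i i0; rewrite -eD => h.
  have : q i - q i0 \in <<[:: e1; e2]>>%VS by [].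
  rewrite span_cons span_seq1 => /memv_addP[z1 /vlineP[r ->] [z2 /vlineP[s ->] e]].
  have c3 (t : R) (j : 'I_3) : coord b j (t *: e1) = t * (j == 1)%:R.
    by rewrite linearZ /= (coord_free 1 j fr3) /= eq_sym.
  have c4 (t : R) (j : 'I_3) : coord b j (t *: e2) = t * (j == 2)%:R.
    by rewrite linearZ /= (coord_free 2 j fr3) /= eq_sym.
  have -> : X i = r by rewrite /X e linearD /= c3 c4 mulr0 mulr1 addr0.
  have -> : Y i = s by rewrite /Y e linearD /= c3 c4 mulr0 mulr1 add0r.
  by rewrite -e addrC subrK.
have inj12 (r s : R) : r *: e1 + s *: e2 = 0 -> r = 0 /\ s = 0.
  move=> e; have f2 : free [tuple e1; e2] by [].
  have /freeP h := f2.
  have {}h : forall i : 'I_2, (if i == 0 then r else s) = 0.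
    by apply: (h (fun i => if i == 0 then r else s)); rewrite !big_ord_recl big_ord0 /= addr0.
  by split; [have := h 0 | have := h 1].
exists X, Y; split.
- move=> al be ga.
  pose f z : R := ga * coord b 0 z + al * coord b 1 z + be * coord b 2 z.
  pose c : 'rV[R]_3 := \row_k f (delta_mx 0 k).
  have fD z z' : f (z + z') = f z + f z' by rewrite /f !linearD /=; ring.
  have fZ r z : f (r *: z) = r * f z by rewrite /f !linearZ /=; ring.
  have f0 : f 0 = 0 by rewrite /f !linear0 !mulr0 !addr0.
  have cf z : dot c z = f z.
    rewrite [in RHS](row_sum_delta z) (big_morph f fD f0).
    by apply: eq_bigr => k _; rewrite fZ mxE mulrC.
  exists c, (dot c (q i0)); split=> [i|].
    rewrite (coor i) !dotD !cf !fZ /f; congr (_ + _).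
    rewrite !(coord_free 1 _ fr3) !(coord_free 2 _ fr3) /=; ring.
  have -> : a = q i0 + e3 by rewrite /e3 addrC subrK.
  rewrite dotD !cf; congr (_ + _); rewrite /f.
  rewrite !(coord_free 0 _ fr3) /=; ring.
- move=> c; exists (dot c e1), (dot c e2), (dot c (q i0)) => i.
  by rewrite (coor i) !dotD !dotZ ![_ * dot c _]mulrC.
- move=> c h; apply/rowP => k; rewrite mxE.
  have cD z : z \in direction q -> dot c z = 0.
    by apply: dot_direction => i j; apply: (h (Some i) (Some j)).
  have -> : c 0 k = dot c (delta_mx 0 k).
    rewrite /dot (bigD1 k) //= big1 ?addr0 => [|j jk]; first by rewrite mxE !eqxx mulr1.
    by rewrite mxE eqxx (negPf jk) mulr0.
  rewrite (coord_basis bas (memvf (delta_mx 0 k))) !big_ord_recl big_ord0 /= !dotD !dotZ.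
  rewrite (cD e1) ?(cD e2) -?eD ?memv_span ?inE ?eqxx ?orbT //.
  rewrite /e3 dotB (h None (Some i0)) subrr !mulr0 !add0r.
  by rewrite /dot big1 // => j _; rewrite mxE mulr0.
- move=> u v x y nuv nxy; rewrite /line_dir.
  have df i j : q j - q i = (X j - X i) *: e1 + (Y j - Y i) *: e2.
    by rewrite (coor j) (coor i) !scalerBl opprD addrACA subrr add0r opprD addrACA.
  split=> [e|].
    have : q v - q u \in <[q y - q x]>%VS by rewrite -e memv_line.
    move=> /vlineP[k]; rewrite !df => ek.
    have [] := inj12 ((X v - X u) - k * (X y - X x)) ((Y v - Y u) - k * (Y y - Y x)).
      have comb (r r' s s' : R) : (r - k * r') *: e1 + (s - k * s') *: e2
          = r *: e1 + s *: e2 - k *: (r' *: e1 + s' *: e2).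
        by rewrite !scalerBl scalerDr !scalerA opprD addrACA.
      by rewrite comb ek subrr.
    move=> /eqP; rewrite subr_eq0 => /eqP h1 /eqP; rewrite subr_eq0 => /eqP h2.
    by rewrite /cross h1 h2; ring.
  have sub i j k l : k != l -> cross X Y k l i j = 0 -> (<[q j - q i]> <= <[q l - q k]>)%VS.
    move=> nkl par; pose N := (X l - X k) ^+ 2 + (Y l - Y k) ^+ 2.
    have N0 : N != 0.
      rewrite paddr_eq0 ?sqr_ge0 // !sqrf_eq0 !subr_eq0; apply/negP => /andP[/eqP h1 /eqP h2].
      by case/eqP: nkl; apply: injq; rewrite (coor k) (coor l) h1 h2.
    pose t := ((X l - X k) * (X j - X i) + (Y l - Y k) * (Y j - Y i)) / N.
    rewrite -memvE; apply/vlineP; exists t; rewrite !df scalerDr !scalerA.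
    congr (_ *: _ + _ *: _); rewrite /t mulrAC; apply: (canRL (mulfK N0)).
      rewrite -[RHS]addr0 -(mulr0 (Y k - Y l)) -par /cross /N; ring.
    by rewrite -[RHS]addr0 -(mulr0 (X l - X k)) -par /cross /N; ring.
  move=> par; apply/eqP; rewrite eqEsubv !sub //.
  by rewrite crossC par oppr0.
- move=> x y; have [/existsP //|no] := boolP [exists k, (k != x) && (k != y)].
  exfalso; have xy k : k = x \/ k = y.
    have : ~~ ((k != x) && (k != y)) by apply: contra no => ?; apply/existsP; exists k.
    by rewrite negb_and !negbK => /orP[]/eqP; [left|right].
  have : (direction q <= <[q y - q x]>)%VS.
    apply/span_subvP => z /mapP[[i j] _ -> /=].
    case: (xy i) => ->; case: (xy j) => ->; rewrite ?subrr ?mem0v ?memv_line //.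
    by rewrite -opprB memvN memv_line.
  by move/dimvS; rewrite dim2 dim_vline; case: (_ != 0).
Qed.

End PyramidCoordinates.

Lemma dot0l (R : realType) (z : 'rV[R]_3) : dot 0 z = 0.
Proof. by rewrite /dot big1 // => k _; rewrite mxE mul0r. Qed.

Section PyramidSquares.
Variables (R : realType) (I : finType) (q : I -> 'rV[R]_3) (a : 'rV[R]_3).
Variables X Y : I -> R.
Hypotheses (injq : injective q) (vertex_q : forall i, is_vertex q i).
Hypothesis coords : base_coordinates q a X Y.

Local Notation p := (pyramid q a).
Local Notation ccw := (ccw X Y).
Local Notation ar2 := (area2 X Y).

Let realize : forall al be ga : R, exists c, exists k : R,
  (forall i, dot c (q i) = k + (al * X i + be * Y i)) /\ dot c a = k + ga.
Proof. by case: coords. Qed.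

Let extract : forall c, exists al be k : R, forall i, dot c (q i) = k + (al * X i + be * Y i).
Proof. by case: coords. Qed.

Lemma pyramid_full_dim c : (forall o o', dot c (p o) = dot c (p o')) -> c = 0.
Proof. by case: coords => _ _ + _ _; apply. Qed.

Let third : forall x y : I, exists k, (k != x) && (k != y).
Proof. by case: coords. Qed.

Let exposed_q i : exposed q [set i].
Proof. exact: vertex_exposed. Qed.

Lemma base_strict_vertex i : exists al be : R,
  forall j, j != i -> al * X j + be * Y j < al * X i + be * Y i.
Proof.
have [c [M [ci cj]]] := exposed_q i; have [al [be [k h]]] := extract c.
exists al, be => j ji; have := cj j; rewrite inE ji => /(_ isT).
by rewrite -(ci i) ?inE // !h ltrD2l.
Qed.

Lemma pyramid_vertex o : exposed p [set o].
Proof.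
case: o => [i|].
  have [al [be h]] := base_strict_vertex i.
  have [c [k [cq ca]]] := realize al be (al * X i + be * Y i - 1).
  exists c, (k + (al * X i + be * Y i)); split=> [o|[j|]].
  - by rewrite inE => /eqP-> /=; rewrite cq.
  - by rewrite inE /= cq ltrD2l => ji; apply: h; apply: contraNneq ji => ->.
  - by move=> _ /=; rewrite ca ltrD2l; lra.
have [c [k [cq ca]]] := realize 0 0 1.
exists c, (k + 1); split=> [o|[j|]]; rewrite inE.
- by move=> /eqP-> /=; rewrite ca.
- by move=> _ /=; rewrite cq ltrD2l; lra.
- by rewrite eqxx.
Qed.

Lemma exposed_ccw u v : u != v ->
  (exists al be : R, al * X u + be * Y u = al * X v + be * Y v /\
     forall k, k != u -> k != v -> al * X k + be * Y k < al * X u + be * Y u)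
  <-> ccw u v || ccw v u.
Proof.
move=> nuv; split=> [[al [be [e h]]]|].
  exact: (ccw_plane_edge base_strict_vertex third nuv e h).
have exp u' v' : ccw u' v' -> exists al be : R, al * X u' + be * Y u' = al * X v' + be * Y v' /\
     forall k, k != u' -> k != v' -> al * X k + be * Y k < al * X u' + be * Y u'.
  move=> /ccwP[_ h]; exists (Y v' - Y u'), (X u' - X v'); split=> [|k ku kv]; first by ring.
  by have := h k ku kv; rewrite /area2; lra.
case/orP=> /exp // [al [be [e h]]]; exists al, be; split=> // k ku kv.
by rewrite -e h.
Qed.

Lemma base_edgeP u v : is_edge q [set u; v] <-> ccw u v || ccw v u.
Proof.
split.
  move/is_edgeP => /(_ exposed_q)[nuv [c [M [cM cnM]]]]; apply/(exposed_ccw nuv).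
  have [al [be [k h]]] := extract c; exists al, be.
  have eu : dot c (q u) = M by apply: cM; rewrite !inE eqxx.
  have ev : dot c (q v) = M by apply: cM; rewrite !inE eqxx orbT.
  rewrite h in eu; rewrite h in ev; split=> [|j ju jv]; first by lra.
  by have := cnM j; rewrite !inE negb_or ju jv h => /(_ isT); lra.
move=> uv; have nuv : u != v by case/orP: uv => /ccwP[] //; rewrite eq_sym.
have /(exposed_ccw nuv)[al [be [e h]]] := uv.
apply/is_edgeP => //; split=> //; have [c [k [cq _]]] := realize al be 0.
exists c, (k + (al * X u + be * Y u)); split=> j; rewrite !inE.
  by case/orP=> /eqP->; rewrite cq // e.
by rewrite negb_or cq ltrD2l => /andP[ju jv]; apply: h.
Qed.

Lemma pyramid_base_edgeP u v : is_edge p [set Some u; Some v] <-> ccw u v || ccw v u.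
Proof.
split.
  move/is_edgeP => /(_ pyramid_vertex)[nuv [c [M [cM cnM]]]].
  have {}nuv : u != v by apply: contraNneq nuv => ->.
  apply/(exposed_ccw nuv).
  have [al [be [k h]]] := extract c; exists al, be.
  have eu : dot c (q u) = M by apply: (cM (Some u)); rewrite !inE eqxx.
  have ev : dot c (q v) = M by apply: (cM (Some v)); rewrite !inE eqxx orbT.
  rewrite h in eu; rewrite h in ev; split=> [|j ju jv]; first by lra.
  have := cnM (Some j); rewrite !inE negb_or /= h => hj.
  by have := hj _; rewrite /eq_op /= ju jv => /(_ isT); lra.
move=> uv; have nuv : u != v by case/orP: uv => /ccwP[] //; rewrite eq_sym.
have /(exposed_ccw nuv)[al [be [e h]]] := uv.
apply/(is_edgeP _ _ pyramid_vertex); split; first by apply: contraNneq nuv => -[->].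
have [c [k [cq ca]]] := realize al be (al * X u + be * Y u - 1).
exists c, (k + (al * X u + be * Y u)); split=> -[j|]; rewrite !inE //=.
- by case/orP=> /eqP[->]; rewrite cq // e.
- rewrite negb_or cq ltrD2l => /andP[ju jv]; apply: h.
    by apply: contraNneq ju => ->.
  by apply: contraNneq jv => ->.
- by move=> _; rewrite ca ltrD2l; lra.
Qed.

Lemma lateral_edge u : is_edge p [set None; Some u].
Proof.
apply/(is_edgeP _ _ pyramid_vertex); split=> //.
have [al [be h]] := base_strict_vertex u.
have [c [k [cq ca]]] := realize al be (al * X u + be * Y u).
exists c, (k + (al * X u + be * Y u)); split=> -[j|]; rewrite !inE //=.
- by move=> /eqP[->]; rewrite cq.
- by rewrite cq ltrD2l => ju; apply: h; apply: contraNneq ju => ->.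
Qed.

Let squareP := is_squareP pyramid_full_dim pyramid_vertex.

Lemma no_lateral_pair v w : ~~ is_square p (cell None v None w).
Proof.
apply/negP => /(square_uniq pyramid_full_dim pyramid_vertex).
by rewrite /= !inE /= orbT.
Qed.

Lemma opposite_nonconst o v' w w' : opposite p (Some o) v' (Some w) w' ->
  exists al be : R,
  [/\ al * X o + be * Y o < al * X w + be * Y w,
      forall k, al * X o + be * Y o <= al * X k + be * Y k <= al * X w + be * Y w,
      forall k, v' = Some k -> al * X k + be * Y k = al * X o + be * Y o &
      forall k, w' = Some k -> al * X k + be * Y k = al * X w + be * Y w].
Proof.
move=> [c [A [B [c0 [e1 e2] [e3 e4] h]]]].
have AB := opposite_lt pyramid_full_dim c0 e1 h.
have [al [be [k cq]]] := extract c; exists al, be.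
rewrite /= cq in e1; rewrite /= cq in e3; split.
- by move: AB; lra.
- by move=> j; have := h (Some j); rewrite /= cq -e1 -e3 !lerD2l.
- by move=> j ej; move: e2; rewrite ej /= cq; lra.
- by move=> j ej; move: e4; rewrite ej /= cq; lra.
Qed.

Lemma level_cross (al be : R) u v x y w :
  al * X u + be * Y u = al * X v + be * Y v -> al * X x + be * Y x = al * X y + be * Y y ->
  al * X w + be * Y w != al * X x + be * Y x -> cross X Y x y u v = 0.
Proof.
move=> e1 e2 nw.
have : (al * X w + be * Y w - (al * X x + be * Y x)) * cross X Y x y u v = 0.
  have -> : (al * X w + be * Y w - (al * X x + be * Y x)) * cross X Y x y u v
    = - ((al * (X y - X x) + be * (Y y - Y x)) * cross X Y u v x w
         + (al * (X v - X u) + be * (Y v - Y u)) * cross X Y x w x y).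
    by rewrite /cross; ring.
  have -> : al * (X y - X x) + be * (Y y - Y x) = 0 by lra.
  have -> : al * (X v - X u) + be * (Y v - Y u) = 0 by lra.
  by rewrite !mul0r addr0 oppr0.
by move/eqP; rewrite mulf_eq0 subr_eq0 (negPf nw) => /eqP.
Qed.

Lemma base_square_parallel x k u l :
  is_square p (cell (Some x) (Some k) (Some u) (Some l)) -> cross X Y x k u l = 0.
Proof.
move=> /squareP[_ _ /opposite_nonconst[al [be [lt _ ek el]]]].
by apply: (@level_cross al be _ _ _ _ u); rewrite ?(ek k) ?(el l) // gt_eqF.
Qed.

Lemma lateral_squareP w x y : is_square p (cell None (Some w) (Some x) (Some y)) <->
  (ccw x y || ccw y x) /\ forall k, `|ar2 x y k| <= `|ar2 x y w|.
Proof.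
split.
  rewrite cellNl => /squareP[_ /pyramid_base_edgeP exy op]; split=> //.
  have [al [be [lt h _ ey]]] := opposite_nonconst op; have {}ey := ey y erefl.
  have main x' y' : ccw x' y' -> al * X x' + be * Y x' = al * X x + be * Y x ->
     al * X y' + be * Y y' = al * X x + be * Y x -> forall k, ar2 x' y' k <= ar2 x' y' w.
    move=> xy' ex' ey' k.
    pose L z := al * (X z - X x') + be * (Y z - Y x').
    have id : (- L w) * ar2 x' y' k = (- L k) * ar2 x' y' w.
      apply/eqP; rewrite -subr_eq0; apply/eqP.
      have -> : - L w * ar2 x' y' k - - L k * ar2 x' y' w =
        - (al * (X y' - X x') + be * (Y y' - Y x')) * ar2 x' w k.
        by rewrite /L /area2; ring.
      have -> : al * (X y' - X x') + be * (Y y' - Y x') = 0 by lra.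
      by rewrite oppr0 mul0r.
    have Lw : 0 < - L w by rewrite /L; lra.
    rewrite -(ler_pM2l Lw) id ler_wpM2r ?ccw_area2_ge0 // /L.
    by have /andP[h1 _] := h k; lra.
  case/orP: exy => xy; first by apply/(top_abs _ xy)/main.
  suff hh k : `|ar2 y x k| <= `|ar2 y x w|.
    by move=> k; have := hh k; rewrite !(area2_rev _ _ x y) !normrN.
  by move: k; apply/(top_abs _ xy)/main.
move=> [exy top]; apply/squareP; split; first exact: lateral_edge.
  exact/pyramid_base_edgeP.
have main x' y' : ccw x' y' -> (forall k, ar2 x' y' k <= ar2 x' y' w) ->
    opposite p None (Some w) (Some x') (Some y').
  move=> xy' topw; pose al := Y y' - Y x'; pose be := X x' - X y'.
  have [c [k [cq ca]]] := realize al be (al * X w + be * Y w).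
  have e z : al * X z + be * Y z = al * X x' + be * Y x' - ar2 x' y' z.
    by rewrite /al /be /area2; ring.
  exists c, (k + (al * X w + be * Y w)), (k + (al * X x' + be * Y x')); split.
  - have [j /andP[jx jy]] := third x' y'; have [_ /(_ j jx jy) j0] := ccwP _ _ _ _ xy'.
    apply/eqP => c0; have := cq x'; have := cq w; rewrite c0 (e w) !dot0l.
    by have := topw j; lra.
  - by rewrite /= ca cq.
  - by rewrite /= !cq (e y') area2_ijj subr0.
  - have w0 := ccw_area2_ge0 w xy'.
    case=> [z|] /=; rewrite ?cq ?ca !lerD2l ?lexx (e w) ?(e z); last by lra.
    by have := topw z; have := ccw_area2_ge0 z xy'; lra.
case/orP: exy => xy; first by apply: main => //; apply/(top_abs _ xy).
have [|c [A [B [c0 e1 [e2 e3] h]]]] := main y x xy.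
  by apply/(top_abs _ xy) => k; rewrite !(area2_rev _ _ x y) !normrN.
by exists c, A, B; split.
Qed.

Lemma parallel_edgesP u v x y : parallel_edges q u v x y <->
  [/\ ccw u v || ccw v u, ccw x y || ccw y x, [set u; v] != [set x; y]
    & cross X Y x y u v = 0].
Proof.
have [_ _ _ dir _] := coords.
have ne u' v' : ccw u' v' || ccw v' u' -> u' != v'.
  by case/orP=> /ccwP[] //; rewrite eq_sym.
split=> [[/base_edgeP e1 /base_edgeP e2 nuv]|[e1 e2 nuv]];
  have d := dir _ _ _ _ (ne _ _ e1) (ne _ _ e2).
  by move=> /d par; split.
by move=> /d par; split=> //; apply/base_edgeP.
Qed.

Lemma parallel_edgesC u v x y : parallel_edges q u v x y -> parallel_edges q x y u v.
Proof.
move=> /parallel_edgesP[e1 e2 n par]; apply/parallel_edgesP; split=> //.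
  by rewrite eq_sym.
by rewrite crossC par oppr0.
Qed.

Lemma parallel_edgesNl u v x y : parallel_edges q u v x y -> parallel_edges q v u x y.
Proof.
move=> /parallel_edgesP[e1 e2 n par]; apply/parallel_edgesP; split=> //.
- by rewrite orbC.
- by rewrite finset.setUC.
- by rewrite crossNr par oppr0.
Qed.

Lemma parallel_edgesNr u v x y : parallel_edges q u v x y -> parallel_edges q u v y x.
Proof. by move/parallel_edgesC/parallel_edgesNl/parallel_edgesC. Qed.

Lemma parallel_uniq u v x y : parallel_edges q u v x y -> uniq [:: x; y; u; v].
Proof.
move=> /parallel_edgesP[e1 /orP[xy|yx] n par].
  by have [] := top_of_parallel base_strict_vertex xy e1 n par.
have [||] := top_of_parallel base_strict_vertex yx e1.
- by rewrite finset.setUC [[set y; x]]finset.setUC finset.setUC.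
- by rewrite crossNl par oppr0.
rewrite /= !inE !negb_or (eq_sym y x).
by move=> /and3P[/and3P[-> -> ->] /andP[-> ->] ->].
Qed.

Lemma parallel_top u v x y : parallel_edges q u v x y ->
  ar2 x y u = ar2 x y v /\ forall k, `|ar2 x y k| <= `|ar2 x y u|.
Proof.
move=> /parallel_edgesP[e1 /orP[xy|yx] n par].
  have [_ e top] := top_of_parallel base_strict_vertex xy e1 n par.
  by split=> //; apply/(top_abs _ xy).
have [||_ e top] := top_of_parallel base_strict_vertex yx e1.
- by rewrite [[set y; x]]finset.setUC.
- by rewrite crossNl par oppr0.
split=> [|k]; first by rewrite !(area2_rev _ _ y x) e.
by rewrite !(area2_rev _ _ y x) !normrN; apply: ((top_abs _ yx).2 top).
Qed.

Lemma parallel_lateral_square u v x y : parallel_edges q u v x y ->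
  is_square p (cell None (Some u) (Some x) (Some y)).
Proof.
move=> par; apply/lateral_squareP; split; first by case/parallel_edgesP: par.
by case: (parallel_top par).
Qed.

Lemma lateral_square_parallel w v x y : w != v ->
  is_square p (cell None (Some w) (Some x) (Some y)) ->
  is_square p (cell None (Some v) (Some x) (Some y)) -> parallel_edges q w v x y.
Proof.
move=> nwv /lateral_squareP[exy topw] /lateral_squareP[_ topv].
have main x' y' : ccw x' y' -> (forall k, ar2 x' y' k <= ar2 x' y' w) ->
   (forall k, ar2 x' y' k <= ar2 x' y' v) -> parallel_edges q w v x' y'.
  move=> xy tw tv; have e : ar2 x' y' w = ar2 x' y' v by apply/le_anti; rewrite tw tv.
  apply/parallel_edgesP; split.
  - exact: (parallel_of_top base_strict_vertex third xy nwv tw e).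
  - by rewrite xy.
  - have [j /andP[jx jy]] := third x' y'; have [_ /(_ j jx jy) j0] := ccwP _ _ _ _ xy.
    apply/eqP => /setP/(_ w); rewrite !inE eqxx => /esym/orP[]/eqP ew.
      by have := tw j; rewrite ew area2_iji; lra.
    by have := tw j; rewrite ew area2_ijj; lra.
  - by rewrite cross_area2 e subrr.
case/orP: exy => xy; first by apply: main => //; apply/(top_abs _ xy).
apply: parallel_edgesNr; apply: main => //; apply/(top_abs _ xy) => k;
  by rewrite !(area2_rev _ _ x y) !normrN.
Qed.

Lemma parallel_base_square u v x y : parallel_edges q u v x y ->
  is_square p (cell (Some u) (Some v) (Some x) (Some y)).
Proof.
move=> par; apply/squareP.
have /parallel_edgesP[e1 e2 _ _] := par; split; try exact/pyramid_base_edgeP.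
have main x' y' : ccw x' y' -> parallel_edges q u v x' y' ->
    opposite p (Some u) (Some v) (Some x') (Some y').
  move=> xy /[dup] par' /parallel_top[euv /(top_abs _ xy) topu].
  pose al := Y y' - Y x'; pose be := X x' - X y'.
  have [c [k [cq ca]]] := realize al be (al * X u + be * Y u).
  have e z : al * X z + be * Y z = al * X x' + be * Y x' - ar2 x' y' z.
    by rewrite /al /be /area2; ring.
  exists c, (k + (al * X u + be * Y u)), (k + (al * X x' + be * Y x')); split.
  - have [j /andP[jx jy]] := third x' y'; have [_ /(_ j jx jy) j0] := ccwP _ _ _ _ xy.
    apply/eqP => c0; have := cq x'; have := cq u; rewrite c0 (e u) !dot0l.
    by have := topu j; lra.
  - by rewrite /= !cq (e v) (e u) euv.
  - by rewrite /= !cq (e y') area2_ijj subr0.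
  - have w0 := ccw_area2_ge0 u xy.
    case=> [z|] /=; rewrite ?cq ?ca !lerD2l ?lexx (e u) ?(e z); last by lra.
    by have := topu z; have := ccw_area2_ge0 z xy; lra.
case/orP: e2 => xy; first exact: main.
have [c [A [B [c0 e1' [e2 e3] h]]]] := main y x xy (parallel_edgesNr par).
by exists c, A, B; split.
Qed.

Lemma side_squares x y u v k l : ccw x y -> ccw u v -> parallel_edges q u v x y ->
  is_square p (cell (Some x) k (Some v) l) ->
  [\/ k = Some y /\ l = Some u, k = Some y /\ l = None | k = None /\ l = Some u].
Proof.
move=> xy uv par sq; have := square_uniq pyramid_full_dim pyramid_vertex sq.
have /squareP[_ _ /opposite_nonconst[al [be [lt h hk hl]]]] := sq.
have /parallel_edgesP[_ _ n cr] := par.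
have [ey eu] := trapezoid_side base_strict_vertex xy uv n cr h.
have [nxy _] := ccwP _ _ _ _ xy; have [nuv _] := ccwP _ _ _ _ uv.
rewrite /= !inE !negb_or => /and3P[/andP[xk _] _ vl].
have Ek j : k = Some j -> j = y.
  move=> ek; apply: (level_edge base_strict_vertex nxy _ ey (hk j ek) (w := v)).
    by apply: contraNneq xk => <-; rewrite ek.
  by rewrite gt_eqF.
have El j : l = Some j -> j = u.
  move=> el; apply: (level_edge base_strict_vertex _ _ eu (hl j el) (w := x)).
  - by rewrite eq_sym.
  - by move: vl; rewrite el andbT; apply: contraNneq => ->.
  - by rewrite lt_eqF.
case: k sq {hk} Ek xk => [k'|] sq Ek xk; case: l sq {hl} El vl => [l'|] sq El vl.
- by constructor 1; rewrite (Ek k') // (El l').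
- by constructor 2; rewrite (Ek k').
- by constructor 3; rewrite (El l').
- by move: (no_lateral_pair (Some x) (Some v)); rewrite cellNl cellNr sq.
Qed.

End PyramidSquares.

(** * Blocks and belts *)

Lemma eq_set2 (T : finType) (x y z w : T) : ([set x; y] == [set z; w]) =
  (x == z) && (y == w) || (x == w) && (y == z).
Proof.
apply/eqP/orP => [e|[]/andP[/eqP-> /eqP->]//]; last exact: finset.setUC.
have [exz|nxz] := eqVneq x z.
  by left; apply/eqP; apply: (@set2_inj _ x); rewrite e exz.
have : x \in [set z; w] by rewrite -e !inE eqxx.
rewrite !inE (negPf nxz) /= => /eqP exw; right; rewrite exw eqxx /=.
by apply/eqP; apply: (@set2_inj _ x); rewrite e exw finset.setUC.
Qed.

Lemma set_neq (T : finType) (A B : {set T}) c (a0 b0 : bool) :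
  (c \in A) = a0 -> (c \in B) = b0 -> a0 != b0 -> A != B.
Proof. by move=> <- <-; apply: contraNneq => ->. Qed.

Lemma subset_imp (T : finType) (A B : {set T}) c (a0 b0 : bool) :
  A \subset B -> (c \in A) = a0 -> (c \in B) = b0 -> a0 -> b0.
Proof. by move=> /fintype.subsetP sub <- <-; apply: sub. Qed.

Lemma lateral_mem_lateral (I : finType) (w w' x y : I) :
  ([set None; Some w] \in cell None (Some w') (Some x) (Some y)) = (w == w').
Proof. by rewrite !inE !eq_set2 /= ?andbF ?orbF. Qed.

Lemma lateral_mem_base (I : finType) (w u v x y : I) :
  ([set None; Some w] \in cell (Some u) (Some v) (Some x) (Some y)) = false.
Proof. by rewrite !inE !eq_set2. Qed.

Definition block_cells (I : finType) (u v x y : I) :=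
  [:: cellB u v x y; cellU u x y; cellV v x y; cellX u v x; cellY u v y].

Lemma block_cells_uniq (I : finType) (u v x y : I) :
  uniq [:: x; y; u; v] -> uniq (block_cells u v x y).
Proof.
rewrite /= !inE !negb_or => /and4P[/and3P[xy xu xv] /andP[yu yv] uv _].
have base w i j : cell (Some u) (Some v) (Some x) (Some y) != cell None (Some w) (Some i) (Some j).
  by apply: contraFneq (lateral_mem_base w u v x y) => ->; rewrite lateral_mem_lateral.
have lat w w' i j i' j' : w != w' ->
    cell None (Some w) (Some i) (Some j) != cell None (Some w') (Some i') (Some j').
  by apply: contraNneq => e; rewrite -(lateral_mem_lateral w w' i' j') -e lateral_mem_lateral.
by rewrite !base !lat // eq_sym.
Qed.

Section Blocks.
Variables (R : realType) (I : finType) (q : I -> 'rV[R]_3) (a : 'rV[R]_3).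
Variables X Y : I -> R.
Hypotheses (injq : injective q) (vertex_q : forall i, is_vertex q i).
Hypothesis coords : base_coordinates q a X Y.

Local Notation p := (pyramid q a).
Implicit Types (Z : C2 p) (S : square p) (u v w x y : I).

Let third : forall x y : I, exists k, (k != x) && (k != y).
Proof. by case: coords. Qed.

Let vert := pyramid_vertex injq vertex_q coords.
Let full := pyramid_full_dim coords.
Let su := square_uniq full vert.
Let sa := square_antipodal_edge full vert.
Let strict := base_strict_vertex injq vertex_q coords.

Lemma apex_edge_sum Z x y : boundary Z = 0 ->
  \sum_w coef Z None (Some w) (Some x) (Some y) = 0.
Proof.
move=> /(boundary_eq0P su sa) Z0.
have NN k l : coef Z None k None l = 0.
  by apply/eqP/negPn/negP => /coef_neq0; rewrite (negPf (no_lateral_pair injq vertex_q coords _ _)).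
have NN' k l : coef Z None k l None = 0 by rewrite (coefNr su) NN oppr0.
have DD k l : coef Z None None k l = 0.
  by apply/eqP/negPn/negP => /coef_neq0/su.
apply: (apex_flow_eq0 strict third (C := fun w x y => coef Z None (Some w) (Some x) (Some y))).
- by move=> w x' y'; rewrite (coefNr su).
- by move=> w x' y' /coef_neq0/(lateral_squareP injq vertex_q coords).
- move=> x'; rewrite -[RHS](Z0 None (Some x')) (boundary_at_coef su).
  rewrite big_option [X in _ = X + _]big1 ?add0r => [|l _]; last by rewrite DD.
  under [RHS]eq_bigr do rewrite big_option NN' add0r.
  by rewrite exchange_big.
- move=> o.
  apply: (area_pairing (D := fun s k t l => ratr (coef Z s k t l))).
  + by move=> s k t l; rewrite (coefNl su) rmorphN.
  + by move=> s k t l; rewrite (coefNr su) rmorphN.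
  + by move=> s k t l; rewrite coefC rmorphN.
  + by move=> s t; rewrite (coefNl su) (coefNr su) NN !oppr0 rmorph0.
  + move=> x' k u l; have [->|n0] := eqVneq (coef Z (Some x') (Some k) (Some u) (Some l)) 0.
      by rewrite rmorph0 mul0r.
    by rewrite (base_square_parallel injq vertex_q coords (coef_neq0 n0)) mulr0.
  + move=> x' u; rewrite -[RHS](rmorph0 (@ratr R)) -(Z0 (Some x') (Some u)).
    rewrite (boundary_at_coef su) rmorph_sum; apply: eq_bigr => k _.
    by rewrite rmorph_sum.
Qed.

Lemma lateral_coefs Z u v x y : boundary Z = 0 -> parallel_edges q u v x y ->
  coef Z None (Some v) (Some x) (Some y) = - coef Z None (Some u) (Some x) (Some y).
Proof.
move=> Z0 par; have := apex_edge_sum x y Z0.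
have := parallel_uniq injq vertex_q coords par.
rewrite /= !inE !negb_or => /and4P[/and3P[xy xu xv] /andP[yu yv] uv _].
have [euv _] := parallel_top injq vertex_q coords par.
rewrite (bigD1 u) //= (bigD1 v) 1?eq_sym //= big1 => [|w /andP[wu wv]].
  by rewrite addr0 => /eqP; rewrite addrC addr_eq0 => /eqP.
apply/eqP/negPn/negP => /coef_neq0 sqw.
have uw : u != w by rewrite eq_sym.
have par' := lateral_square_parallel injq vertex_q coords uw
  (parallel_lateral_square injq vertex_q coords par) sqw.
have [euw _] := parallel_top injq vertex_q coords par'.
have lev z : (Y y - Y x) * X z + (X x - X y) * Y z
    = (Y y - Y x) * X x + (X x - X y) * Y x - area2 X Y x y z.
  by rewrite /area2; ring.
case/eqP: wv; apply: (level_edge strict uv wu (al := Y y - Y x) (be := X x - X y) (w := x)).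
- by rewrite (lev v) (lev u) euv.
- by rewrite (lev w) (lev u) euw.
- by rewrite (lev u) -subr_eq0 opprB addrC subrK (area2_neq0 strict).
Qed.

(* The antipodal edge joining the ends x, v of a side of the trapezoid lies on
   three squares only, all of them in the block. *)
Lemma side_relation Z u v x y : boundary Z = 0 -> ccw X Y x y -> ccw X Y u v ->
  parallel_edges q u v x y ->
  coef Z (Some u) (Some v) (Some x) (Some y) + coef Z None (Some v) (Some x) (Some y)
  = coef Z (Some u) (Some v) None (Some x).
Proof.
move=> /(boundary_eq0P su sa) Z0 xy uv par.
have := Z0 (Some x) (Some v); rewrite (boundary_at_coef su).
have side k l : [|| (k == Some y) && (l == Some u), (k == Some y) && (l == None)
      | (k == None) && (l == Some u)] || (coef Z (Some x) k (Some v) l == 0).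
  have [//|/coef_neq0 sq] := eqVneq (coef Z (Some x) k (Some v) l) 0; first by rewrite orbT.
  by case: (side_squares injq vertex_q coords xy uv par sq) => -[-> ->]; rewrite !eqxx ?orbT.
rewrite (bigD1 (Some y)) //= [X in _ + X = _](bigD1 None) //= [X in _ + (_ + X) = _]big1 => [|k /andP[ky kN]]; last first.
  by apply: big1 => l _; have := side k l; rewrite (negPf ky) (negPf kN) => /eqP.
rewrite addr0 (bigD1 (Some u)) //= [X in (_ + X) + _ = _](bigD1 None) //= [X in _ + (_ + X) + _ = _]big1 => [|l /andP[lu lN]]; last first.
  by have := side (Some y) l; rewrite (negPf lu) (negPf lN) andbF /= => /eqP.
rewrite addr0 [X in _ + X = _](bigD1 (Some u)) //= big1 => [|l lu]; last first.
  by have := side None l; rewrite (negPf lu) /= => /eqP.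
rewrite addr0 (coefC _ (Some v)) (coefNl su _ (Some u)) opprK.
rewrite (coefC _ (Some v) None) (coefNl su _ None) opprK.
rewrite (coefC _ (Some v) (Some u)) (coefNl su _ (Some u)) opprK.
by rewrite (coefNr su _ _ _ None (Some x)) => /eqP; rewrite subr_eq0 => /eqP.
Qed.

Lemma base_coef Z u v x y : boundary Z = 0 -> parallel_edges q u v x y ->
  coef Z (Some u) (Some v) (Some x) (Some y)
  = coef Z None (Some u) (Some x) (Some y) + coef Z (Some u) (Some v) None (Some x).
Proof.
move=> Z0 par.
have main u' v' x' y' : parallel_edges q u' v' x' y' -> ccw X Y x' y' -> ccw X Y u' v' ->
    coef Z (Some u') (Some v') (Some x') (Some y')
    = coef Z None (Some u') (Some x') (Some y') + coef Z (Some u') (Some v') None (Some x').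
  move=> par' xy uv; have := side_relation Z0 xy uv par'.
  by rewrite (lateral_coefs Z0 par') => <-; rewrite addrC subrK.
have /(parallel_edgesP injq vertex_q coords)[uv xy _ _] := par.
have lat u' v' x' y' : parallel_edges q u' v' x' y' ->
    coef Z (Some u') (Some v') None (Some y') = - coef Z (Some u') (Some v') None (Some x').
  move=> par'; rewrite !(coefC _ None) (lateral_coefs Z0 (u := x')) //.
  exact: (parallel_edgesC injq vertex_q coords par').
case/orP: uv => uv; case/orP: xy => xy.
- exact: main.
- have := main u v y x (parallel_edgesNr injq vertex_q coords par) xy uv.
  by rewrite !(coefNr su _ _ _ (Some x) (Some y)) (lat _ _ _ _ par) -opprD => /oppr_inj.
- have := main v u x y (parallel_edgesNl injq vertex_q coords par) xy uv.
  by rewrite !(coefNl su _ (Some u) (Some v)) (lateral_coefs Z0 par) -opprD => /oppr_inj.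
- have := main v u y x (parallel_edgesNl injq vertex_q coords
    (parallel_edgesNr injq vertex_q coords par)) xy uv.
  rewrite !(coefNl su _ (Some u) (Some v)) !(coefNr su _ _ _ (Some x) (Some y)) (lat _ _ _ _ par).
  by rewrite (lateral_coefs Z0 par) !opprK.
Qed.

Lemma square_in_block Z S : boundary Z = 0 -> Z S != 0 ->
  exists u v x y, parallel_edges q u v x y /\ val S \in block_cells u v x y.
Proof.
move=> Z0 nzS.
have lat w x y : val S = cell None (Some w) (Some x) (Some y) ->
    exists u v x y, parallel_edges q u v x y /\ val S \in block_cells u v x y.
  move=> eS; have sq : is_square p (cell None (Some w) (Some x) (Some y)).
    by rewrite -eS (valP S).
  have n0 : coef Z None (Some w) (Some x) (Some y) != 0.
    by apply: contraNneq nzS => e; rewrite (square_coef su Z eS) e mul0r.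
  have [w' nww' n0'] : exists2 w', w != w' & coef Z None (Some w') (Some x) (Some y) != 0.
    have [/existsP[w' /andP[n1 n2]]|no] :=
      boolP [exists w', (w != w') && (coef Z None (Some w') (Some x) (Some y) != 0)].
      by exists w'.
    case/eqP: n0; rewrite -[RHS](apex_edge_sum x y Z0) (bigD1 w) //= big1 ?addr0 // => w' nw.
    apply/eqP/negPn/negP => n0'; case/negP: no; apply/existsP; exists w'.
    by rewrite eq_sym nw n0'.
  exists w, w', x, y; split; last by rewrite eS !inE eqxx orbT.
  exact: (lateral_square_parallel injq vertex_q coords nww' sq (coef_neq0 n0')).
have [v [v' [w [w' eS]]]] := square_cellP S.
have sq : is_square p (cell v v' w w') by rewrite -eS (valP S).
have apex k l m : val S = cell None k l m ->
    exists u v x y, parallel_edges q u v x y /\ val S \in block_cells u v x y.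
  move=> e; have {}sq : is_square p (cell None k l m) by rewrite -e (valP S).
  case: k e sq => [k|] e sq; last by have := su sq.
  case: l e sq => [l|] e sq; last by have := no_lateral_pair injq vertex_q coords (Some k) m; rewrite sq.
  case: m e sq => [m|] e sq; first exact: lat e.
  by have := no_lateral_pair injq vertex_q coords (Some k) (Some l); rewrite cellNr sq.
case: v eS sq => [v|] eS sq; last exact: apex eS.
case: v' eS sq => [v'|] eS sq; last by apply: (apex (Some v) w w'); rewrite eS cellNl.
case: w eS sq => [w|] eS sq; last by apply: (apex w' (Some v) (Some v')); rewrite eS cellC.
case: w' eS sq => [w'|] eS sq; last first.
  by apply: (apex (Some w) (Some v) (Some v')); rewrite eS cellC cellNl.
exists v, v', w, w'; split; last by rewrite eS !inE eqxx.
have := su sq; rewrite /= !inE !negb_or => /andP[/and3P[_ vw vw'] _].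
have /(is_squareP full vert)[/(pyramid_base_edgeP injq vertex_q coords) e1] := sq.
move=> /(pyramid_base_edgeP injq vertex_q coords) e2 _.
apply/(parallel_edgesP injq vertex_q coords); split=> //.
  apply/eqP => /setP/(_ v); rewrite !inE eqxx /= => /esym/orP[]/eqP ev.
    by rewrite ev eqxx in vw.
  by rewrite ev eqxx in vw'.
by rewrite crossC (base_square_parallel injq vertex_q coords sq) oppr0.
Qed.

Definition local_belt u v x y (s t : rat) : C2 p :=
  let B := oriented_cell p (Some u) (Some v) (Some x) (Some y) in
  s *: (B + oriented_cell p None (Some u) (Some x) (Some y)
          - oriented_cell p None (Some v) (Some x) (Some y))
  + t *: (B + oriented_cell p (Some u) (Some v) None (Some x)
          - oriented_cell p (Some u) (Some v) None (Some y)).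

Lemma local_beltsP u v x y Z :
  Z \in local_belts u v x y q a <-> exists s t, Z = local_belt u v x y s t.
Proof.
rewrite /local_belts span_cons span_seq1; split.
  by move=> /memv_addP[_ /vlineP[s ->] [_ /vlineP[t ->] ->]]; exists s, t.
by move=> [s [t ->]]; apply: memv_add; apply/vlineP; [exists s|exists t].
Qed.

Lemma local_beltE u v x y s t S : local_belt u v x y s t S =
  (s + t) * oriented_cell p (Some u) (Some v) (Some x) (Some y) S
  + s * oriented_cell p None (Some u) (Some x) (Some y) S
  - s * oriented_cell p None (Some v) (Some x) (Some y) S
  + t * oriented_cell p (Some u) (Some v) None (Some x) S
  - t * oriented_cell p (Some u) (Some v) None (Some y) S.
Proof. by rewrite /local_belt !ffunE /GRing.scale /=; ring. Qed.

Lemma boundary_at_oriented_cell (v v' w w' i j : option I) : is_square p (cell v v' w w') ->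
  boundary_at (oriented_cell p v v' w w') i j = crossings [:: v; w; v'; w'] i j.
Proof.
move=> sq; pose S : square p := exist (fun s => is_true (is_square p s)) _ sq.
have eS : val S = cell v v' w w' by [].
rewrite /boundary_at (bigD1 S) //= big1 ?addr0 => [|S' nS].
  rewrite oriented_cellE eS eqxx mul1r (crossings_square su eS i j) mulrA -expr2.
  by rewrite (crossings_square_sqr su eS) mul1r.
rewrite oriented_cellE (_ : val S' == _ = false) ?mul0r ?mul0r //.
by apply: contraNF nS => /eqP e; apply/eqP/val_inj.
Qed.

Lemma block_squares u v x y : parallel_edges q u v x y ->
  forall W, W \in block_cells u v x y -> is_square p W.
Proof.
move=> par W; rewrite !inE => /or4P[|||/orP[]] /eqP->.
- exact: (parallel_base_square injq vertex_q coords par).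
- exact: (parallel_lateral_square injq vertex_q coords par).
- exact: (parallel_lateral_square injq vertex_q coords (parallel_edgesNl injq vertex_q coords par)).
- exact: (parallel_lateral_square injq vertex_q coords (parallel_edgesC injq vertex_q coords par)).
- apply: (parallel_lateral_square injq vertex_q coords).
  exact: (parallel_edgesNl injq vertex_q coords (parallel_edgesC injq vertex_q coords par)).
Qed.

Lemma boundary_local_belt u v x y s t : parallel_edges q u v x y ->
  boundary (local_belt u v x y s t) = 0.
Proof.
move=> par; apply/(boundary_eq0P su sa) => i j.
have sq := block_squares par.
transitivity ((s + t) * boundary_at (oriented_cell p (Some u) (Some v) (Some x) (Some y)) i j
  + s * boundary_at (oriented_cell p None (Some u) (Some x) (Some y)) i j
  - s * boundary_at (oriented_cell p None (Some v) (Some x) (Some y)) i j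
  + t * boundary_at (oriented_cell p (Some u) (Some v) None (Some x)) i j
  - t * boundary_at (oriented_cell p (Some u) (Some v) None (Some y)) i j).
  rewrite /boundary_at !mulr_sumr -!sumrN -!big_split /=; apply: eq_bigr => S _.
  by rewrite local_beltE; ring.
have sB : is_square p (cellB u v x y) by apply: sq; rewrite !inE eqxx.
have sU : is_square p (cellU u x y) by apply: sq; rewrite !inE eqxx ?orbT.
have sV : is_square p (cellV v x y) by apply: sq; rewrite !inE eqxx ?orbT.
have sX : is_square p (cellX u v x) by apply: sq; rewrite !inE eqxx ?orbT.
have sY : is_square p (cellY u v y) by apply: sq; rewrite !inE eqxx ?orbT.
rewrite /cellX cellC in sX; rewrite /cellY cellC in sY.
rewrite !boundary_at_oriented_cell //.
rewrite !crossings4 !(stepNl None) (stepNl (Some u) (Some x)) (stepNl (Some u) (Some y)).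
rewrite (stepNl (Some v) (Some x)).
ring.
Qed.

Lemma local_belt_block u v x y s t : parallel_edges q u v x y ->
  [/\ forall S : square p, val S = cellB u v x y -> local_belt u v x y s t S =
        (s + t) * crossings (attaching_cycle (val S)) (Some u) (Some x),
      forall S : square p, val S = cellU u x y -> local_belt u v x y s t S =
        s * crossings (attaching_cycle (val S)) None (Some x),
      forall S : square p, val S = cellV v x y -> local_belt u v x y s t S =
        - s * crossings (attaching_cycle (val S)) None (Some x),
      forall S : square p, val S = cellX u v x -> local_belt u v x y s t S =
        t * crossings (attaching_cycle (val S)) (Some u) None
    & forall S : square p, val S = cellY u v y -> local_belt u v x y s t S =
        - t * crossings (attaching_cycle (val S)) (Some u) None].
Proof.
move=> par; have := block_cells_uniq (parallel_uniq injq vertex_q coords par).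
rewrite [X in is_true X -> _]/= !inE !negb_or andbT => /and4P[/and4P[BU BV BX BY] /and3P[UV UX UY] /andP[VX VY] XY].
have ne (A A' : {set {set option I}}) : A != A' -> ((A == A') = false) * ((A' == A) = false).
  by move=> n; rewrite [A' == A]eq_sym (negPf n).
have nes := (ne _ _ BU, ne _ _ BV, ne _ _ BX, ne _ _ BY, ne _ _ UV, ne _ _ UX, ne _ _ UY,
  ne _ _ VX, ne _ _ VY, ne _ _ XY).
have main S : local_belt u v x y s t S =
    (s + t) * ((val S == cellB u v x y)%:R * crossings (attaching_cycle (val S)) (Some u) (Some x))
  + s * ((val S == cellU u x y)%:R * crossings (attaching_cycle (val S)) None (Some x))
  - s * ((val S == cellV v x y)%:R * crossings (attaching_cycle (val S)) None (Some x))
  + t * ((val S == cellX u v x)%:R * crossings (attaching_cycle (val S)) (Some u) None)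
  - t * ((val S == cellY u v y)%:R * crossings (attaching_cycle (val S)) (Some u) None).
  rewrite local_beltE !oriented_cellE.
  by rewrite !(cellC (Some u) (Some v) None).
by split=> S eS; rewrite main eS eqxx !nes ?mulr0n ?mulr1n; ring.
Qed.

Lemma local_belt_out u v x y s t S : val S \notin block_cells u v x y ->
  local_belt u v x y s t S = 0.
Proof.
rewrite !inE !negb_or => /and5P[/negPf nB /negPf nU /negPf nV /negPf nX /negPf nY].
rewrite local_beltE !oriented_cellE !(cellC (Some u) (Some v) None).
rewrite -/(cellB u v x y) -/(cellU u x y) -/(cellV v x y) -/(cellX u v x) -/(cellY u v y).
by rewrite nB nU nV nX nY !mulr0n; ring.
Qed.

Lemma mem_support Z (W : {set {set option I}}) :
  reflect (exists2 S : square p, val S = W & Z S != 0) (W \in Defs.support Z).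
Proof.
apply: (iffP imsetP) => [[S + ->]|[S <- nz]]; first by rewrite inE; exists S.
by exists S; rewrite ?inE.
Qed.

Lemma support_local_belt u v x y s t (W : {set {set option I}}) : parallel_edges q u v x y ->
  W \in Defs.support (local_belt u v x y s t) =
  [|| (W == cellB u v x y) && (s + t != 0),
      ((W == cellU u x y) || (W == cellV v x y)) && (s != 0)
    | ((W == cellX u v x) || (W == cellY u v y)) && (t != 0)].
Proof.
move=> par; set L := local_belt u v x y s t.
have [LB LU LV LX LY] := local_belt_block s t par.
have ex (v' w k l : option I) (A : rat) (sq : is_square p (cell v' w k l)) :
    (forall S : square p, val S = cell v' w k l -> L S = A * crossings (attaching_cycle (val S)) v' k) ->
    (cell v' w k l \in Defs.support L) = (A != 0).
  move=> h; pose S : square p := exist (fun s => is_true (is_square p s)) _ sq.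
  have eS : val S = cell v' w k l by [].
  have nz : crossings (attaching_cycle (val S)) v' k != 0.
    by rewrite -sqrf_eq0 (crossings_square_sqr su eS) oner_eq0.
  apply/mem_support/idP => [[S' eS' ]|nA]; last by exists S => //; rewrite (h S eS) mulf_neq0.
  by rewrite (val_inj (etrans eS' (esym eS))) (h S eS) mulf_eq0 negb_or => /andP[].
have sq := block_squares par.
have sB : is_square p (cellB u v x y) by apply: sq; rewrite !inE eqxx.
have sU : is_square p (cellU u x y) by apply: sq; rewrite !inE eqxx ?orbT.
have sV : is_square p (cellV v x y) by apply: sq; rewrite !inE eqxx ?orbT.
have sX : is_square p (cellX u v x) by apply: sq; rewrite !inE eqxx ?orbT.
have sY : is_square p (cellY u v y) by apply: sq; rewrite !inE eqxx ?orbT.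
have := block_cells_uniq (parallel_uniq injq vertex_q coords par).
rewrite [X in is_true X -> _]/= !inE !negb_or andbT.
move=> /and4P[/and4P[BU BV BX BY] /and3P[UV UX UY] /andP[VX VY] XY].
have ne (A A' : {set {set option I}}) : A != A' -> ((A == A') = false) * ((A' == A) = false).
  by move=> n; rewrite [A' == A]eq_sym (negPf n).
have nes := (ne _ _ BU, ne _ _ BV, ne _ _ BX, ne _ _ BY, ne _ _ UV, ne _ _ UX, ne _ _ UY,
  ne _ _ VX, ne _ _ VY, ne _ _ XY).
have [->|nWB] := eqVneq W (cellB u v x y); first by rewrite !nes !orbF (ex _ _ _ _ _ sB LB).
have [->|nWU] := eqVneq W (cellU u x y); first by rewrite !nes !orbF (ex _ _ _ _ _ sU LU).
have [->|nWV] := eqVneq W (cellV v x y).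
  by rewrite !nes !orbF (ex _ _ _ _ _ sV LV) oppr_eq0.
have [->|nWX] := eqVneq W (cellX u v x).
  rewrite {1}/cellX cellC; rewrite /cellX cellC in sX LX.
  by rewrite (ex _ _ _ _ _ sX LX).
have [->|nWY] := eqVneq W (cellY u v y).
  rewrite {1}/cellY cellC; rewrite /cellY cellC in sY LY.
  by rewrite (ex _ _ _ _ _ sY LY) oppr_eq0.
apply/mem_support => -[S eS]; rewrite local_belt_out ?eqxx // eS !inE.
by rewrite (negPf nWB) (negPf nWU) (negPf nWV) (negPf nWX) (negPf nWY).
Qed.

Lemma local_belt00 u v x y : local_belt u v x y 0 0 = 0.
Proof. by rewrite /local_belt !scale0r addr0. Qed.

Lemma block_circuitsP u v x y : parallel_edges q u v x y -> 
  [/\ Defs.support (local_belt u v x y 1 0) = [set cellB u v x y; cellU u x y; cellV v x y],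
      Defs.support (local_belt u v x y 0 1) = [set cellB u v x y; cellX u v x; cellY u v y]
    & Defs.support (local_belt u v x y 1 (-1)) =
      [set cellU u x y; cellV v x y; cellX u v x; cellY u v y]].
Proof.
move=> par; split; apply/setP => W; rewrite support_local_belt // !inE.
- by rewrite addr0 oner_eq0 eqxx !andbT !andbF !orbF orbA.
- by rewrite add0r oner_eq0 eqxx !andbT !andbF orFb orbA.
- by rewrite subrr oppr_eq0 oner_eq0 eqxx !andbT andbF orFb !orbA.
Qed.

Lemma support_local_belt_scale u v x y s t s' t' : parallel_edges q u v x y ->
  (s == 0) = (s' == 0) -> (t == 0) = (t' == 0) -> (s + t == 0) = (s' + t' == 0) ->
  Defs.support (local_belt u v x y s t) = Defs.support (local_belt u v x y s' t').
Proof.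
move=> par es et est; apply/setP => W.
have := support_local_belt s' t' W par; rewrite -es -et -est => e.
exact: etrans (support_local_belt s t W par) (esym e).
Qed.

Lemma block_circuits_uniq u v x y : parallel_edges q u v x y -> uniq (block_circuits u v x y).
Proof.
move=> par; have [e1 e2 e3] := block_circuitsP par.
rewrite /block_circuits -e1 -e2 -e3.
have mB s t := support_local_belt s t (cellB u v x y) par.
have mU s t := support_local_belt s t (cellU u x y) par.
have := block_cells_uniq (parallel_uniq injq vertex_q coords par).
rewrite [X in is_true X -> _]/= !inE !negb_or andbT.
move=> /and4P[/and4P[BU BV BX BY] /and3P[UV UX UY] _ _].
rewrite (negPf BU) (negPf BV) (negPf BX) (negPf BY) eqxx !orbF in mB.
rewrite [_ == cellB _ _ _ _]eq_sym (negPf BU) (negPf UX) (negPf UY) eqxx !orbF in mU.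
have uniq3 (T : eqType) (A B C : T) : A != B -> A != C -> B != C -> uniq [:: A; B; C].
  by move=> ab ac bc; rewrite /= !inE negb_or ab ac bc.
apply: uniq3.
- exact: set_neq (mU 1 0) (mU 0 1) isT.
- exact: set_neq (mB 1 0) (mB 1 (-1)) isT.
- exact: set_neq (mB 0 1) (mB 1 (-1)) isT.
Qed.

Lemma local_circuits u v x y (W : {set {set {set option I}}}) : parallel_edges q u v x y ->
  primitive_circuit [set Z | Z \in local_belts u v x y q a]%classic W <->
  W \in block_circuits u v x y.
Proof.
move=> par; have [e1 e2 e3] := block_circuitsP par.
have := block_cells_uniq (parallel_uniq injq vertex_q coords par).
rewrite [X in is_true X -> _]/= !inE !negb_or andbT.
move=> /and4P[/and4P[BU BV BX BY] /and3P[UV UX UY] /andP[VX VY] XY].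
have mB s t : (cellB u v x y \in Defs.support (local_belt u v x y s t)) = (s + t != 0).
  by rewrite support_local_belt // eqxx (negPf BU) (negPf BV) (negPf BX) (negPf BY) !orbF.
have mU s t : (cellU u x y \in Defs.support (local_belt u v x y s t)) = (s != 0).
  by rewrite support_local_belt // [_ == cellB _ _ _ _]eq_sym eqxx (negPf BU)
    (negPf UX) (negPf UY) !orbF.
have mX s t : (cellX u v x \in Defs.support (local_belt u v x y s t)) = (t != 0).
  have ne (A A' : {set {set option I}}) : A != A' -> (A' == A) = false.
    by move=> n; rewrite eq_sym (negPf n).
  by rewrite support_local_belt // (ne _ _ BX) (ne _ _ UX) (ne _ _ VX) eqxx.
have nz Z c : c \in Defs.support Z -> Z != 0.
  by move=> /mem_support[S _]; apply: contraNneq => ->; rewrite ffunE.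
have n10 : local_belt u v x y 1 0 != 0 by apply: (nz _ (cellU u x y)); rewrite mU oner_eq0.
have n01 : local_belt u v x y 0 1 != 0 by apply: (nz _ (cellX u v x)); rewrite mX oner_eq0.
have n11 : local_belt u v x y 1 (-1) != 0 by apply: (nz _ (cellU u x y)); rewrite mU oner_eq0.
have prim s0 t0 : local_belt u v x y s0 t0 != 0 ->
    (forall s t, local_belt u v x y s t != 0 ->
       Defs.support (local_belt u v x y s t) \subset Defs.support (local_belt u v x y s0 t0) ->
       [/\ (s == 0) = (s0 == 0), (t == 0) = (t0 == 0) & (s + t == 0) = (s0 + t0 == 0)]) ->
    primitive_in [set Z | Z \in local_belts u v x y q a]%classic (local_belt u v x y s0 t0).
  move=> n0 h; split=> //; first by apply/local_beltsP; exists s0, t0.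
  move=> Z' /local_beltsP[s [t ->]] n0' /(h _ _ n0')[es et est].
  exact: support_local_belt_scale.
rewrite -e1 -e2 -e3; split.
  move=> [Z [/local_beltsP[s [t ->]] n0 min] <-].
  have [s0|s0] := eqVneq s 0.
    have t0 : t != 0 by apply: contraNneq n0 => ->; rewrite s0 local_belt00.
    apply/orP; right; apply/orP; left; apply/eqP/support_local_belt_scale => //.
    - by rewrite s0 eqxx.
    - by rewrite (negPf t0) oner_eq0.
    - by rewrite s0 !add0r (negPf t0) oner_eq0.
  have [t0|t0] := eqVneq t 0.
    apply/orP; left; apply/eqP/support_local_belt_scale => //.
    - by rewrite (negPf s0) oner_eq0.
    - by rewrite t0 eqxx.
    - by rewrite t0 !addr0 (negPf s0) oner_eq0.
  have [st0|st0] := eqVneq (s + t) 0.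
    apply/orP; right; apply/orP; right; apply/eqP/support_local_belt_scale => //.
    - by rewrite (negPf s0) oner_eq0.
    - by rewrite (negPf t0) oppr_eq0 oner_eq0.
    - by rewrite st0 subrr eqxx.
  have in10 : local_belt u v x y 1 0 \in local_belts u v x y q a.
    by apply/local_beltsP; exists 1, 0.
  have sub10 : Defs.support (local_belt u v x y 1 0) \subset Defs.support (local_belt u v x y s t).
    apply/fintype.subsetP => W' h; apply: etrans (support_local_belt s t W' par) _.
    move: (etrans (esym (support_local_belt 1 0 W' par)) h).
    by rewrite s0 t0 st0 addr0 oner_eq0 eqxx !andbT andbF orbF !orbA => ->.
  have eX := congr1 (fun D : {set _} => cellX u v x \in D) (min _ in10 n10 sub10).
  by have := etrans (esym (mX 1 0)) (etrans eX (mX s t)); rewrite t0 eqxx.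
case/or3P=> /eqP->.
- exists (local_belt u v x y 1 0) => //; apply: prim => // s t n0 sub.
  have := subset_imp sub (mX s t) (mX 1 0); rewrite eqxx => t0.
  have {}t0 : t = 0 by apply/eqP/negPn/negP => /t0.
  have s0 : s != 0 by apply: contraNneq n0 => ->; rewrite t0 local_belt00.
  by rewrite t0 !addr0 (negPf s0) oner_eq0 eqxx.
- exists (local_belt u v x y 0 1) => //; apply: prim => // s t n0 sub.
  have := subset_imp sub (mU s t) (mU 0 1); rewrite eqxx => s0.
  have {}s0 : s = 0 by apply/eqP/negPn/negP => /s0.
  have t0 : t != 0 by apply: contraNneq n0 => ->; rewrite s0 local_belt00.
  by rewrite s0 !add0r (negPf t0) oner_eq0 eqxx.
- exists (local_belt u v x y 1 (-1)) => //; apply: prim => // s t n0 sub.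
  have := subset_imp sub (mB s t) (mB 1 (-1)); rewrite subrr eqxx => st0.
  have {}st0 : s + t = 0 by apply/eqP/negPn/negP => /st0.
  have s0 : s != 0.
    apply: contraNneq n0 => s0; have t0 : t = 0 by rewrite -st0 s0 add0r.
    by rewrite s0 t0 local_belt00.
  have t0 : t != 0 by apply: contraNneq s0 => t0; rewrite -st0 t0 addr0.
  by split; rewrite ?st0 ?(negPf s0) ?(negPf t0).
Qed.

Lemma belt_on_block Z u v x y : boundary Z = 0 -> parallel_edges q u v x y ->
  forall S : square p, val S \in block_cells u v x y ->
  Z S = local_belt u v x y (coef Z None (Some u) (Some x) (Some y))
                           (coef Z (Some u) (Some v) None (Some x)) S.
Proof.
move=> Z0 par S; set s := coef _ None _ _ _; set t := coef _ _ _ None _.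
have [LB LU LV LX LY] := local_belt_block s t par.
rewrite !inE => /or4P[|||/orP[]] /eqP eS.
- by rewrite (LB S eS) (square_coef su Z eS) (base_coef Z0 par).
- by rewrite (LU S eS) (square_coef su Z eS).
- by rewrite (LV S eS) (square_coef su Z eS) (lateral_coefs Z0 par).
- rewrite (LX S eS); rewrite /cellX cellC in eS.
  by rewrite (square_coef su Z eS).
- rewrite (LY S eS); rewrite /cellY cellC in eS.
  rewrite (square_coef su Z eS) (coefC _ None); congr (- _ * _).
  have par' := parallel_edgesC injq vertex_q coords par.
  by rewrite (lateral_coefs Z0 par') -coefC.
Qed.

Lemma belt_circuits (W : {set {set {set option I}}}) : primitive_circuit (@rational_belt R (option I) p) W <->
  exists u v x y, parallel_edges q u v x y /\ W \in block_circuits u v x y.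
Proof.
have beltP u v x y Z : parallel_edges q u v x y -> Z \in local_belts u v x y q a ->
    boundary Z = 0.
  by move=> par /local_beltsP[s [t ->]]; apply: boundary_local_belt.
split=> [[Z [Z0 nZ min] eW]|[u [v [x [y [par]]]]]].
  have [S nS] : exists S, Z S != 0.
    have [/existsP//|no] := boolP [exists S, Z S != 0].
    case/eqP: nZ; apply/ffunP => S; rewrite ffunE; apply/eqP/negPn/negP => nS.
    by case/negP: no; apply/existsP; exists S.
  have [u [v [x [y [par bS]]]]] := square_in_block Z0 nS.
  exists u, v, x, y; split=> //; apply/(local_circuits W par).
  pose L := local_belt u v x y (coef Z None (Some u) (Some x) (Some y))
                               (coef Z (Some u) (Some v) None (Some x)).
  have LZ S' : val S' \in block_cells u v x y -> Z S' = L S' by apply: belt_on_block.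
  have inL : L \in local_belts u v x y q a by apply/local_beltsP; do 2 eexists.
  have subL : Defs.support L \subset Defs.support Z.
    apply/fintype.subsetP => W' /mem_support[S' eS' nS']; apply/mem_support; exists S' => //.
    rewrite LZ //; apply/negPn/negP => out.
    by rewrite /L local_belt_out ?eqxx in nS'.
  have nL : L != 0 by apply: contraNneq nS => L0; rewrite LZ // L0 ffunE.
  have eL : Defs.support L = Defs.support Z by apply: min => //; apply: (beltP _ _ _ _ _ par inL).
  exists L; last by rewrite eL.
  split=> // Z' inZ' nZ' sub'; rewrite eL; apply: min => //.
    exact: (beltP _ _ _ _ _ par inZ').
  by rewrite -eL.
move=> /(local_circuits W par)[Z [inZ nZ min] <-]; exists Z => //.
split=> //; first exact: (beltP _ _ _ _ _ par inZ).
move=> Z' Z'0 nZ' sub; apply: min => //.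
apply/local_beltsP; do 2 eexists; apply/ffunP => S.
have [bS|out] := boolP (val S \in block_cells u v x y).
  exact: (belt_on_block Z'0 par).
rewrite local_belt_out //; apply/eqP/negPn/negP => nS.
have /(fintype.subsetP sub)/mem_support[S' eS'] : val S \in Defs.support Z' by apply/mem_support; exists S.
have /local_beltsP[s [t ->]] := inZ.
by rewrite local_belt_out ?eqxx // eS'.
Qed.

End Blocks.

Theorem corollary10p11 (R : realType) (n : nat) (q : 'I_n -> 'rV[R]_3)
    (a : 'rV[R]_3) :
  convex_polygon q -> no_collinear_adjacent_edges q -> ~ affine_hull q a ->
  (forall u v x y : 'I_n, parallel_edges q u v x y ->
     uniq (block_circuits u v x y) /\
     (forall W : {set {set {set option 'I_n}}},
        primitive_circuit [set Z | Z \in local_belts u v x y q a]%classic W <->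
        W \in block_circuits u v x y)) /\
  (forall W : {set {set {set option 'I_n}}},
     primitive_circuit (@rational_belt R (option 'I_n) (pyramid q a)) W <->
     exists u v x y : 'I_n,
       parallel_edges q u v x y /\ W \in block_circuits u v x y).
Proof.
move=> polyQ _ offQ; have [X [Y coords]] := base_coordinates_exist polyQ offQ.
have [injq vertex_q _] := polyQ; split=> [u v x y par|W].
  split; first exact: (block_circuits_uniq injq vertex_q coords par).
  by move=> W; apply: (local_circuits injq vertex_q coords W par).
exact: (belt_circuits injq vertex_q coords W).
Qed.
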